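(* Let $M$ be a compact Riemannian manifold, $\mathcal F$ a family of $C^1$ local diffeomorphisms $f:M\to M$ endowed with the $C^1$ topology, $\alpha>0$ and $c>0$. Let $$\mathcal H_c=\{(f,\phi)\in\mathcal F\times C^\alpha(M):\ \phi \text{ is a } c\text{-hyperbolic potential for } f, \text{ and } \{f^{-n}(x)\}_{n\ge 0}\text{ is dense in } M \text{ for all } x\in M\},$$ with the topology induced by the product topology of $\mathcal F\times C^\alpha(M)$. Then the function $\mathcal H_c\to\mathbb R$, $(f,\phi)\mapsto P_f(\phi)$, is continuous.
   Context: $C^\alpha(M)$ is the space of functions $\varphi:M\to\mathbb R$ with $\|\varphi\|_\alpha=\|\varphi\|_0+|\varphi|_\alpha<\infty$, where $\|\cdot\|_0$ is the sup norm and $|\varphi|_\alpha=\sup_{x\ne y}|\varphi(x)-\varphi(y)|/d(x,y)^\alpha$; it carries the norm $\|\cdot\|_\alpha$. The set $\{f^{-n}(x)\}_{n\ge0}$ is $\bigcup_{n\ge0}f^{-n}(x)$. Relative pressure: let $X$ be a compact metric space, $T:X\to X$ and $\phi:X\to\mathbb R$ continuous. For $\delta>0$, $n\in\mathbb N$, $x\in X$ let $B_\delta(x,n)=\{y\in X: d(T^j(x),T^j(y))<\delta \text{ for } 0\le j\le n\}$, $S_n\phi=\sum_{j=0}^{n-1}\phi\circ T^j$ and $R_{n,\delta}\phi(x)=\sup_{y\in B_\delta(x,n)}S_n\phi(y)$. For $\Lambda\subset X$, $N\in\mathbb N$ and $\gamma\in\mathbb R$ let $m_T(\phi,\Lambda,\delta,N,\gamma)=\inf_{\mathcal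 U}\sum_{B_\delta(x,n)\in\mathcal U}e^{-\gamma n+R_{n,\delta}\phi(x)}$, the infimum over all finite or countable families $\mathcal U$ of dynamic balls $B_\delta(x,n)$ with $x\in X$, $n\ge N$, covering $\Lambda$. Put $m_T(\phi,\Lambda,\delta,\gamma)=\lim_{N\to\infty}m_T(\phi,\Lambda,\delta,N,\gamma)$, $P_T(\phi,\Lambda,\delta)=\inf\{\gamma: m_T(\phi,\Lambda,\delta,\gamma)=0\}$, and $P_T(\phi,\Lambda)=\lim_{\delta\to0}P_T(\phi,\Lambda,\delta)$. The topological pressure is $P_T(\phi)=P_T(\phi,X)$; by the variational principle it equals $\sup_\eta\{h_\eta(T)+\int\phi\,d\eta\}$ over $T$-invariant Borel probabilities $\eta$. Hyperbolic potentials: for $f\in\mathcal F$, $\Sigma_c(f)$ is the set of $x\in M$ with $\limsup_{n\to\infty}\frac1n\sum_{j=0}^{n-1}\log\|Df(f^j(x))^{-1}\|\le -c$. A continuous $\phi:M\to\mathbb R$ is a $c$-hyperbolic potential for $f$ if $P_f(\phi,M\setminus\Sigma_c(f))<P_f(\phi,\Sigma_c(f))=P_f(\phi)$. *)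

(* Defs.v *)
From HB Require Import structures.
From mathcomp Require Import all_boot all_order all_algebra.
From mathcomp Require Import all_classical all_reals all_analysis.

Set Implicit Arguments.
Unset Strict Implicit.
Unset Printing Implicit Defensive.

Import Order.TTheory GRing.Theory Num.Theory.
Import numFieldNormedType.Exports.

Local Open Scope classical_set_scope.
Local Open Scope ring_scope.

(* Meant for [U] open.  In finite dimension, continuity of all iterated
   directional derivatives is continuity of the iterated differentials. *)
Fixpoint class_C (R : realType) (V W : normedModType R) (k : nat)
    (U : set V) (f : V -> W) : Prop :=
  if k is k'.+1 then
    (forall x, U x -> differentiable f x) /\
    (forall v : V, class_C k' U (fun x => 'd f x v))
  else forall x, U x -> {for x, continuous f}.

(* A smooth n-dimensional atlas on M, together with a smooth Riemannian metric
   given by its Gram matrices in the charts.  The chart i is the map [crd i] on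
   the open set [dom i], with inverse [par i]; a tangent vector at x is
   represented by a row vector of components in the chart [chart_at x]. *)
Record riemannian_structure (R : realType) (M : metricType R) (n : nat) := {
  chart : Type;
  dom : chart -> set M;
  crd : chart -> M -> 'rV[R]_n;
  par : chart -> 'rV[R]_n -> M;
  chart_at : M -> chart;
  gram : chart -> 'rV[R]_n -> 'M[R]_n;
  open_dom : forall i, open (dom i);
  open_crd : forall i, open (crd i @` dom i);
  crdK : forall i x, dom i x -> par i (crd i x) = x;
  crd_continuous : forall i x, dom i x -> {for x, continuous (crd i)};
  par_continuous : forall i p, (crd i @` dom i) p -> {for p, continuous (par i)};
  dom_chart_at : forall x, dom (chart_at x) x;
  transition_smooth : forall i j k,
    class_C k (crd i @` (dom i `&` dom j)) (crd j \o par i);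
  gram_smooth : forall i (a b : 'I_n) k,
    @class_C R 'rV[R]_n R^o k (crd i @` dom i) (fun p => gram i p a b);
  gram_sym : forall i x, dom i x -> (gram i (crd i x))^T = gram i (crd i x);
  gram_pos : forall i x (v : 'rV[R]_n), dom i x -> v != 0 ->
    0 < (v *m gram i (crd i x) *m v^T) 0 0;
  gram_tensor : forall i j x, dom i x -> dom j x ->
    let J := 'J (crd j \o par i) (crd i x) in
    gram i (crd i x) = J *m gram j (crd j x) *m J^T
}.

Arguments chart {R M n} r.
Arguments dom {R M n} r c.
Arguments crd {R M n} r c.
Arguments par {R M n} r c.
Arguments chart_at {R M n} r x : rename.
Arguments gram {R M n} r c.

Section Riemannian.
Variables (R : realType) (M : metricType R) (n : nat).
Variable X : riemannian_structure M n.

Definition tangent_norm (x : M) (v : 'rV[R]_n) : R :=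
  Num.sqrt ((v *m gram X (chart_at X x) (crd X (chart_at X x) x) *m v^T) 0 0).

(* Any C^1 curve on [0, 1] is the restriction of a C^1 curve on the line. *)
Definition C1_curve (g : R -> M) : Prop :=
  continuous g /\
  forall i, @class_C R R^o 'rV[R]_n 1 (g @^-1` dom X i) (crd X i \o g).

Definition speed (g : R -> M) (t : R) : R :=
  tangent_norm (g t) (derive1 (crd X (chart_at X (g t)) \o g) t).

Definition curve_length (g : R -> M) : \bar R :=
  \int[lebesgue_measure]_(t in `[0, 1]) (speed g t)%:E.

Definition curves_between (x y : M) : set (R -> M) :=
  [set g | [/\ C1_curve g, g 0 = x & g 1 = y]].

(* If M is connected the nonemptiness hypothesis always holds; without
   connectedness, the distance between distinct components is any distance
   compatible with the topology. *)
Definition riemannian_distance : Prop :=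
  forall x y : M, curves_between x y !=set0 ->
    (mdist x y)%:E = ereal_inf (curve_length @` curves_between x y).

Definition C1_on (U : set M) (f : M -> M) : Prop :=
  (forall x, U x -> {for x, continuous f}) /\
  forall i j, class_C 1 (crd X i @` (U `&` dom X i `&` f @^-1` dom X j))
                        (crd X j \o f \o par X i).

Definition C1_local_diffeo (f : M -> M) : Prop :=
  forall x, exists (U : set M) (g : M -> M),
    [/\ open U, U x & open (f @` U)] /\
    [/\ forall y, U y -> g (f y) = y, C1_on U f & C1_on (f @` U) g].

Record local_diffeo := LocalDiffeo {
  local_diffeo_fun :> M -> M;
  local_diffeoP : C1_local_diffeo local_diffeo_fun
}.

(* Row vectors: Df(x) sends v to v *m differential f x. *)
Definition differential (f : M -> M) (x : M) : 'M[R]_n :=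
  'J (crd X (chart_at X (f x)) \o f \o par X (chart_at X x))
     (crd X (chart_at X x) x).

Definition inv_differential_norm (f : M -> M) (x : M) : R :=
  sup [set tangent_norm x (w *m invmx (differential f x)) |
       w in [set w | tangent_norm (f x) w <= 1]].

(* The C^1 compact-open topology, generated by the sets of all g which are
   C^1-close to f up to e on a compact set K, as read in charts i and j with
   K in dom i and f(K) in dom j. *)
Definition C1_subbasic (f : local_diffeo) (i j : chart X) (K : set M) (e : R) :
    set local_diffeo :=
  [set g | forall x, K x ->
    let rep (h : M -> M) := crd X j \o h \o par X i in
    [/\ dom X j (g x),
        `|rep g (crd X i x) - rep f (crd X i x)| < e &
        `|'J (rep g) (crd X i x) - 'J (rep f) (crd X i x)| < e]].

Definition C1_subbase : set (set local_diffeo) :=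
  [set N | exists (f : local_diffeo) i j (K : set M) (e : R),
    [/\ compact K, K `<=` dom X i, f @` K `<=` dom X j, 0 < e &
        N = C1_subbasic f i j K e]].

HB.instance Definition _ := gen_eqMixin local_diffeo.
HB.instance Definition _ := gen_choiceMixin local_diffeo.
HB.instance Definition _ :=
  isSubBaseTopological.Build local_diffeo C1_subbase id.

End Riemannian.

Section Hoelder.
Variables (R : realType) (M : metricType R) (alpha : R).
Implicit Types phi psi : M -> R.

Definition sup_values phi : set R := [set `|phi x| | x in [set: M]].

Definition hoelder_quotients phi : set R :=
  [set `|phi p.1 - phi p.2| / (mdist p.1 p.2 `^ alpha) |
   p in [set p : M * M | p.1 != p.2]].

(* [sup set0] is 0 for reals, so that the seminorm vanishes on a
   one-point space. *)
Definition hoelder_norm phi : R :=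
  sup (sup_values phi) + sup (hoelder_quotients phi).

Definition is_hoelder : {pred M -> R} := [pred phi : M -> R |
  `[< has_ubound (sup_values phi) /\ has_ubound (hoelder_quotients phi) >]].

Let values_ge0 phi z : sup_values phi z -> 0 <= z.
Proof. by move=> [x _ <-]. Qed.

Let quotients_ge0 phi z : hoelder_quotients phi z -> 0 <= z.
Proof. by move=> [p _ <-]; rewrite divr_ge0// powR_ge0. Qed.

Let sup_leP (A : set R) (b : R) : 0 <= b -> ubound A b -> sup A <= b.
Proof.
move=> b0 Ab; have [->|/set0P A0] := eqVneq A set0; first by rewrite sup0.
exact: ge_sup.
Qed.

Let le_sup_ge0 (A : set R) : (forall z, A z -> 0 <= z) -> 0 <= sup A.
Proof.
move=> A0; have [->|/set0P[z Az]] := eqVneq A set0; first by rewrite sup0.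
have [ubA|nubA] := pselect (has_ubound A).
  exact: le_trans (A0 _ Az) (ub_le_sup ubA Az).
by rewrite sup_out// => -[].
Qed.

Let valuesD phi psi (a b : R) :
  ubound (sup_values phi) a -> ubound (sup_values psi) b ->
  ubound (sup_values (phi + psi)) (a + b).
Proof.
move=> fa gb _ [x _ <-]; rewrite (le_trans (ler_normD _ _))// lerD//.
  by apply: fa; exists x.
by apply: gb; exists x.
Qed.

Let quotientsD phi psi (a b : R) :
  ubound (hoelder_quotients phi) a -> ubound (hoelder_quotients psi) b ->
  ubound (hoelder_quotients (phi + psi)) (a + b).
Proof.
move=> fa gb _ [p pP <-].
have -> : (phi + psi) p.1 - (phi + psi) p.2 =
    (phi p.1 - phi p.2) + (psi p.1 - psi p.2).
  by rewrite !fctE opprD addrACA.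
apply: (@le_trans _ _ (`|phi p.1 - phi p.2| / (mdist p.1 p.2 `^ alpha) +
                       `|psi p.1 - psi p.2| / (mdist p.1 p.2 `^ alpha))).
  by rewrite -mulrDl ler_wpM2r// ?invr_ge0 ?powR_ge0// ler_normD.
by apply: lerD; [apply: fa|apply: gb]; exists p.
Qed.

Let valuesZ (c : R) phi (a : R) :
  ubound (sup_values phi) a -> ubound (sup_values (c *: phi)) (`|c| * a).
Proof.
move=> fa _ [x _ <-]; rewrite [X in `|X|](_ : _ = c * phi x)// normrM.
by rewrite ler_wpM2l//; apply: fa; exists x.
Qed.

Let quotientsZ (c : R) phi (a : R) :
  ubound (hoelder_quotients phi) a ->
  ubound (hoelder_quotients (c *: phi)) (`|c| * a).
Proof.
move=> fa _ [p pP <-].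
rewrite [X in `|X|](_ : _ = c * (phi p.1 - phi p.2)); last by rewrite mulrBr.
by rewrite normrM -mulrA ler_wpM2l//; apply: fa; exists p.
Qed.

Let is_hoelder_submod : submod_closed is_hoelder.
Proof.
split=> [|c phi psi].
  apply/asboolP; split; exists 0.
    by move=> _ [x _ <-]; rewrite normr0.
  by move=> _ [p _ <-]; rewrite subrr normr0 mul0r.
move=> /asboolP[[a fa] [a' fa']] /asboolP[[b gb] [b' gb']].
apply/asboolP; split.
  by exists (`|c| * a + b); apply: valuesD => //; apply: valuesZ.
by exists (`|c| * a' + b'); apply: quotientsD => //; apply: quotientsZ.
Qed.

HB.instance Definition _ :=
  GRing.isSubmodClosed.Build R (M -> R) is_hoelder is_hoelder_submod.

Record hoelder_space := HoelderSpace {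
  hoelder_fun :> M -> R;
  hoelder_funP : hoelder_fun \in is_hoelder
}.

HB.instance Definition _ := [isSub for hoelder_fun].
HB.instance Definition _ := [Choice of hoelder_space by <:].
HB.instance Definition _ := [SubChoice_isSubLmodule of hoelder_space by <:].

Let norm_space (phi : hoelder_space) : R := hoelder_norm phi.

Let ubs (phi : hoelder_space) :
  ubound (sup_values phi) (sup (sup_values phi)) /\
  ubound (hoelder_quotients phi) (sup (hoelder_quotients phi)).
Proof.
have /asboolP[h1 h2] := hoelder_funP phi.
by split=> z Az; apply: ub_le_sup.
Qed.

Let norm_spaceD (phi psi : hoelder_space) :
  norm_space (phi + psi) <= norm_space phi + norm_space psi.
Proof.
have [f1 f2] := ubs phi; have [g1 g2] := ubs psi.
rewrite /norm_space /hoelder_norm addrACA; apply: lerD; apply: sup_leP.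
- by rewrite addr_ge0// le_sup_ge0//; exact: values_ge0.
- exact: valuesD.
- by rewrite addr_ge0// le_sup_ge0//; exact: quotients_ge0.
- exact: quotientsD.
Qed.

Let norm_spaceZ_le (c : R) (phi : hoelder_space) :
  norm_space (c *: phi) <= `|c| * norm_space phi.
Proof.
have [f1 f2] := ubs phi.
rewrite /norm_space /hoelder_norm mulrDr; apply: lerD; apply: sup_leP.
- by rewrite mulr_ge0// le_sup_ge0//; exact: values_ge0.
- exact: valuesZ.
- by rewrite mulr_ge0// le_sup_ge0//; exact: quotients_ge0.
- exact: quotientsZ.
Qed.

Let norm_space_ge0 (phi : hoelder_space) : 0 <= norm_space phi.
Proof.
rewrite /norm_space addr_ge0// le_sup_ge0//; first exact: values_ge0.
exact: quotients_ge0.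
Qed.

Let norm_spaceZ (c : R) (phi : hoelder_space) :
  norm_space (c *: phi) = `|c| * norm_space phi.
Proof.
apply/eqP; rewrite eq_le norm_spaceZ_le/=.
have [->|c0] := eqVneq c 0; first by rewrite normr0 mul0r norm_space_ge0.
rewrite mulrC -ler_pdivlMr ?normr_gt0// mulrC -normfV.
rewrite -[X in norm_space X <= _](scalerK c0).
exact: norm_spaceZ_le.
Qed.

Let norm_space_eq0 (phi : hoelder_space) : norm_space phi = 0 -> phi = 0.
Proof.
move=> /eqP; rewrite paddr_eq0; last 2 first.
- by rewrite le_sup_ge0//; exact: values_ge0.
- by rewrite le_sup_ge0//; exact: quotients_ge0.
move=> /andP[/eqP f0 _]; apply: val_inj; apply/funext => x /=.
apply/eqP; rewrite -normr_le0 -f0.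
by have [f1 _] := ubs phi; apply: f1; exists x.
Qed.

HB.instance Definition _ := Lmodule_isNormed.Build R hoelder_space
  norm_spaceD norm_spaceZ norm_space_eq0.

Lemma hoelder_space_normE (phi : hoelder_space) : `|phi| = hoelder_norm phi.
Proof. by []. Qed.

End Hoelder.

Section Pressure.
Variables (R : realType) (M : metricType R) (T : M -> M) (phi : M -> R).

Definition dyn_ball (delta : R) (x : M) (n : nat) : set M :=
  [set y | forall j, (j <= n)%N -> mdist (iter j T x) (iter j T y) < delta].

Definition birkhoff_sum (n : nat) (y : M) : R := \sum_(j < n) phi (iter j T y).

Definition sup_birkhoff (n : nat) (delta : R) (x : M) : R :=
  sup (birkhoff_sum n @` dyn_ball delta x n).

(* A family of dynamic balls is given by the set of its indices (x, n). *)
Definition dyn_covers (Lambda : set M) (delta : R) (N : nat) :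
    set (set (M * nat)) :=
  [set U | [/\ countable U, forall u, U u -> (N <= u.2)%N &
    Lambda `<=` \bigcup_(u in U) dyn_ball delta u.1 u.2]].

Definition pressure_sum (Lambda : set M) (delta : R) (N : nat) (gamma : R) :
    \bar R :=
  ereal_inf [set \esum_(u in U)
                   (expR (- gamma * u.2%:R + sup_birkhoff u.2 delta u.1))%:E |
             U in dyn_covers Lambda delta N].

Definition pressure_measure (Lambda : set M) (delta gamma : R) : \bar R :=
  limn (fun N => pressure_sum Lambda delta N gamma).

Definition pressure_scale (Lambda : set M) (delta : R) : \bar R :=
  ereal_inf [set gamma%:E |
             gamma in [set gamma | pressure_measure Lambda delta gamma = 0%E]].

Definition relative_pressure (Lambda : set M) : \bar R :=
  lim (pressure_scale Lambda delta @[delta --> 0^'+]).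

Definition pressure : \bar R := relative_pressure [set: M].

End Pressure.

Section Hyperbolic.
Variables (R : realType) (M : metricType R) (n : nat).
Variable X : riemannian_structure M n.

(* [lne] is -oo at 0, a value of the norm in dimension 0 only. *)
Definition expanding_set (c : R) (f : M -> M) : set M :=
  [set x | (limn_esup (fun m : nat => (m%:R^-1)%:E *
      \sum_(j < m) lne (inv_differential_norm X f (iter j f x))%:E)
    <= (- c)%:E)%E].

Definition hyperbolic_potential (c : R) (f : M -> M) (phi : M -> R) : Prop :=
  [/\ continuous phi,
      (relative_pressure f phi (~` expanding_set c f) <
       relative_pressure f phi (expanding_set c f))%E &
      relative_pressure f phi (expanding_set c f) = pressure f phi].

Definition dense_preimages (f : M -> M) : Prop :=
  forall x : M, dense (\bigcup_m (iter m f @^-1` [set x])).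

Definition hyperbolic_pairs (F : set (local_diffeo X)) (alpha c : R) :
    set (local_diffeo X * hoelder_space M alpha) :=
  [set p : local_diffeo X * hoelder_space M alpha |
    [/\ F p.1, hyperbolic_potential c p.1 p.2 & dense_preimages p.1]].

End Hyperbolic.

(* Main.v *)
Require Import Defs.
From HB Require Import structures.
From mathcomp Require Import all_boot all_order all_algebra.
From mathcomp Require Import all_classical all_reals all_analysis.
From mathcomp Require finmap.
From mathcomp Require Import lra ring.
Import Order.TTheory GRing.Theory Num.Theory.
Import numFieldNormedType.Exports.
Local Open Scope classical_set_scope.
Local Open Scope ring_scope.

Set Implicit Arguments.
Unset Strict Implicit.
Unset Printing Implicit Defensive.

(* For a map f of M and a potential phi put
     A_n(x) = \sum_(f^n y = x) exp(S_n phi(y)).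
   If f is a local homeomorphism, a cover of M by dynamic balls with pressure
   sum < 1 at exponent g bounds A_n by C exp(n g), because f^n is injective on
   a small dynamic ball of length n; hence a uniform lower bound
   exp(n th) <= A_n for one n forces th <= P_f(phi).  Conversely, at infinitely
   many hyperbolic times n, a point x of Sigma_c is shadowed by an n-th preimage
   of every point close to f^n x, and since the preimages of any single point
   are uniformly dense, Sigma_c is covered by dynamic balls centred at iterated
   preimages of one freely chosen point.  So P_f(phi, Sigma_c) <= th as soon as
   A_n is at most C exp(n th) at one point for each n.  When
   P_f(phi, Sigma_c) = P_f(phi), the growth rates of min A_n and of max A_n
   therefore both equal P_f(phi).  The first gives lower, the second upper
   semicontinuity, because for fixed n the fibres of f^n and of g^n are in a
   small-displacement bijection when g is C^1-close to f.

   Hyperbolic times are treated in charts: balls are measured in the Gram norm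
   at their centre, and a quantitative inverse function theorem shows that f
   maps a ball at x of radius e^eps |Df(x)^-1| r over the ball at f(x) of radius
   r, uniformly for small r. *)

(** * Sums over fibres *)

(** Nothing makes the shadowing scale or the hyperbolic times uniform among pairs close to a given
    one, so neither is carried from one pair to another. What passes between neighbours is a bound
    on [fiber_sum] at one fixed order. Since A_(n+k) lies between min A_n and max A_n times A_k,
    such a bound spreads to all orders at the new pair. The link with pressure through hyperbolicity
    is made at the nearby pair for upper semicontinuity and at the given pair for lower
    semicontinuity. The lower half argues by contraposition: if min A_n falls below exp(n th) for
    every n > 0, the points where this happens vary with n. The covers by preimages must therefore
    tolerate a base point depending on n, and the density of preimages must be uniform in that
    point. A hyperbolic time leaves room only for a factor below e^c per step. A constant comparing
    two norms would enter at every step and accumulate, so the expansion estimate has to be sharp up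
    to e^eps with eps < c. The Gram norm at each orbit point removes that constant. *)

Lemma esum_le_rel (R : realType) (T T' : choiceType) (I : set T) (J : set T')
    (a : T -> \bar R) (b : T' -> \bar R) (r : T -> T' -> Prop) :
  (forall j, J j -> (0 <= b j)%E) ->
  (forall i, I i -> exists j, [/\ J j, r i j & (a i <= b j)%E]) ->
  (forall i i' j, I i -> I i' -> r i j -> r i' j -> i = i') ->
  (\esum_(i in I) a i <= \esum_(j in J) b j)%E.
Proof.
move=> b0 ex inj.
have [->|/set0P[i0 Ii0]] := eqVneq I set0; first by rewrite esum_set0 esum_ge0.
have [j0 [Jj0 _ _]] := ex _ Ii0.
(* Any choice function for [r] is injective on [I], because each [j] is related to at most one
   [i]. *)
have [e eP] : {e : T -> T' & forall i, I i -> [/\ J (e i), r i (e i) & (a i <= b (e i))%E]}.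
  apply: (@choice T T' (fun i j => I i -> [/\ J j, r i j & (a i <= b j)%E])) => i.
  have [Ii|nIi] := pselect (I i); last by exists j0.
  by have [j jP] := ex _ Ii; exists j.
have ei : set_inj I e.
  move=> i i' /set_mem Ii /set_mem Ii' ee; apply: (inj i i' (e i)) => //.
    by case: (eP i).
  by rewrite ee; case: (eP i').
apply: (@le_trans _ _ (\esum_(i in I) b (e i))%E).
  by apply: le_esum => i Ii; case: (eP i).
rewrite -(esum_image I e b)// esum_mkcond [leRHS]esum_mkcond.
apply: le_esum => j _; case: ifPn => [|_].
  by rewrite inE => -[i Ii <-]; case: (eP i Ii) => Je _ _; rewrite mem_set.
by case: ifPn => //; rewrite inE => /b0.
Qed.

Lemma esum_subset (R : realType) (T : choiceType) (I J : set T)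
    (a : T -> \bar R) :
  (forall j, J j -> (0 <= a j)%E) -> I `<=` J ->
  (\esum_(i in I) a i <= \esum_(i in J) a i)%E.
Proof.
move=> a0 IJ; apply: (esum_le_rel (r := eq)) => //.
- by move=> i Ii; exists i; split=> //; exact: IJ.
- by move=> i i' j _ _ -> ->.
Qed.

Lemma esum_le_cover (R : realType) (T S : choiceType) (s : seq S) (A : set T)
    (B : S -> set T) (a : T -> \bar R) :
  (forall j, A j -> (0 <= a j)%E) ->
  (forall y, A y -> exists2 i, i \in s & B i y) ->
  (\esum_(y in A) a y <= \sum_(i <- s) \esum_(y in A `&` B i) a y)%E.
Proof.
elim: s A => [|i s IHs] A a0 AB.
  rewrite big_nil [X in esum X _](_ : _ = set0) ?esum_set0//.
  by apply/seteqP; split=> // y /AB[].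
rewrite big_cons (esumID (B i))// leeD2l//.
apply: le_trans.
  apply: IHs => [j []|y [Ay nBy]]; first by move=> /a0.
  have [k] := AB _ Ay; rewrite inE => /predU1P[->//|ks By].
  by exists k.
apply: lee_sum => k _; apply: esum_subset => [j [/a0]//|y [[Ay _] By]].
by split.
Qed.

Lemma esum_geometric_tail (R : realType) (C q : R) (N : nat) :
  0 <= C -> 0 < q -> q < 1 ->
  (\esum_(n in [set n | (N <= n)%N]) (C * q ^+ n)%:E <=
     (C * q ^+ N * (1 - q)^-1)%:E)%E.
Proof.
move=> C0 q0 q1.
apply: (@le_trans _ _ (\esum_(i in [set: nat]) (C * q ^+ N * q ^+ i)%:E)%E).
  apply: (esum_le_rel (r := fun n i => n = (N + i)%N)).
  - by move=> i _; rewrite lee_fin !mulr_ge0// exprn_ge0// ltW.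
  - move=> n /= Nn; exists (n - N)%N; split=> //; first by rewrite subnKC.
    by rewrite -mulrA -exprD subnKC.
  - by move=> i i' j _ _ -> ->.
rewrite -nneseries_esumT; last first.
  by move=> i; rewrite lee_fin !mulr_ge0// exprn_ge0// ltW.
apply: lime_le.
  apply: is_cvg_nneseries => n _ _.
  by rewrite lee_fin !mulr_ge0// exprn_ge0// ltW.
apply: nearW => n; rewrite sumEFin lee_fin.
have := @geometric_le_lim R n (C * q ^+ N) q.
rewrite /series/=; apply => //; first by rewrite mulr_ge0// exprn_ge0// ltW.
by rewrite ger0_norm// ltW.
Qed.

Lemma esumZ (R : realType) (T : choiceType) (I : set T) (a : T -> \bar R)
    (c : R) : 0 < c -> (forall i, I i -> (0 <= a i)%E) ->
  (\esum_(i in I) (c%:E * a i) = c%:E * \esum_(i in I) a i)%E.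
Proof.
have le (b : T -> \bar R) (k : R) : 0 < k -> (forall i, I i -> (0 <= b i)%E) ->
    (\esum_(i in I) (k%:E * b i) <= k%:E * \esum_(i in I) b i)%E.
  move=> k0 b0; apply: ge_ereal_sup => _ [X [finX XI] <-].
  (* Truncation at 0 gives a function nonnegative everywhere, whereas [b] is so only on [I]. *)
  rewrite (eq_fsbigr (fun i => k%:E * (maxe 0 (b i)))%E); last first.
    by move=> i /set_mem /XI Ii; rewrite max_r// b0.
  rewrite -ge0_mule_fsumr; last by move=> i; rewrite le_max lexx.
  rewrite (eq_fsbigr b); last by move=> i /set_mem /XI Ii; rewrite max_r// b0.
  apply: lee_wpmul2l; first by rewrite lee_fin ltW.
  by apply: esum_ge; exists X.
move=> c0 a0; apply/eqP; rewrite eq_le le//=.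
rewrite [in leLHS](eq_esum (b := fun i => (c^-1%:E * (c%:E * a i))%E)); last first.
  by move=> i _; rewrite muleA -EFinM mulVf ?gt_eqF// mul1e.
apply: (@le_trans _ _ (c%:E * (c^-1%:E * \esum_(i in I) (c%:E * a i)))%E).
  apply: lee_wpmul2l; first by rewrite lee_fin ltW.
  apply: le; rewrite ?invr_gt0// => i Ii.
  by apply: mule_ge0; [rewrite lee_fin ltW|exact: a0].
by rewrite muleA -EFinM mulfV ?gt_eqF// mul1e.
Qed.

Lemma finite_subcover (X : topologicalType) (I : choiceType) (K : set X)
    (D : set I) (V : I -> set X) :
  compact K -> (forall y, K y -> exists2 i, D i & nbhs y (V i)) ->
  exists2 s : seq I, uniq s /\ (forall i, i \in s -> D i) &
    forall y, K y -> exists2 i, i \in s & V i y.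
Proof.
move=> cK KV.
(* The filter of eventual properties of finite lists from [D], directed by inclusion: compactness in
   its near-covering form along [F] yields one list that serves every point of [K]. *)
pose F : set_system (seq I) := [set P | exists2 s0 : seq I,
  (forall i, i \in s0 -> D i) & forall s : seq I,
  {subset s0 <= s} -> (forall i, i \in s -> D i) -> P s].
have FF : Filter F.
  split.
  - by exists [::].
  - move=> P Q [s sD sP] [t tD tQ]; exists (s ++ t) => [i|u stu uD].
      by rewrite mem_cat => /orP[/sD|/tD].
    split; [apply: sP|apply: tQ] => // i iu; apply: stu;
      by rewrite mem_cat iu ?orbT.
  - by move=> P Q PQ [s sD sP]; exists s => // u su uD; apply: PQ; apply: sP.
have [|s sD h] := iffLR (compact_near_coveringP K) cK _ F
    (fun s y => exists2 i, i \in s & V i y) FF.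
  move=> y Ky; have [i Di Vy] := KV _ Ky.
  exists (V i, [set s : seq I | i \in s]); first split => /=.
  - exact: Vy.
  - exists [:: i] => [j /[!inE] /eqP ->//|s si _].
    by apply: (si i); rewrite inE.
  - by move=> [z s] [/= Vz si]; exists i.
exists (undup s); first by split=> [|i]; rewrite ?undup_uniq// mem_undup => /sD.
move=> y Ky; have [//|//|i si Vy] := h s _ _ y Ky.
by exists i; rewrite ?mem_undup.
Qed.

Section Fibers.
Context {R : realType} {M : metricType R}.
Implicit Types (f g : M -> M) (phi psi : M -> R).

(* The n-th iterate of the transfer operator of [phi], applied to 1. *)
Definition fiber_sum f phi (n : nat) (x : M) : \bar R :=
  \esum_(y in iter n f @^-1` [set x]) (expR (birkhoff_sum f phi n y))%:E.

Definition injective_at_scale (e : R) f :=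
  forall x y, mdist x y < e -> f x = f y -> x = y.

Lemma birkhoff_sumD f phi m n y :
  birkhoff_sum f phi (m + n) y =
  birkhoff_sum f phi m y + birkhoff_sum f phi n (iter m f y).
Proof.
rewrite /birkhoff_sum big_split_ord/=; congr (_ + _).
by apply: eq_bigr => i _; rewrite -iterD addnC.
Qed.

Lemma birkhoff_sum_close f g phi psi (w : R) n y z :
  (forall j, (j < n)%N -> `|phi (iter j f y) - psi (iter j g z)| <= w) ->
  `|birkhoff_sum f phi n y - birkhoff_sum g psi n z| <= n%:R * w.
Proof.
move=> h; rewrite /birkhoff_sum -sumrB (le_trans (ler_norm_sum _ _ _))//.
rewrite mulrC mulr_natr -[X in _ *+ X]card_ord -sumr_const.
by apply: ler_sum => i _; apply: h.
Qed.

Lemma birkhoff_sum_bound f phi (B : R) n y : (forall x, `|phi x| <= B) ->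
  `|birkhoff_sum f phi n y| <= n%:R * B.
Proof.
move=> h; have := @birkhoff_sum_close f f phi (fun=> 0) B n y y.
rewrite /birkhoff_sum [X in _ - X]big1// subr0; apply => j _.
by rewrite subr0.
Qed.

(** The semigroup law of the transfer operator: preimages of order [n + k] are grouped by their
    image under the n-th iterate, and the cocycle identity splits the weight. *)
Lemma fiber_sumD f phi n k x :
  (fiber_sum f phi (n + k) x =
   \esum_(y in iter k f @^-1` [set x])
     ((expR (birkhoff_sum f phi k y))%:E * fiber_sum f phi n y))%E.
Proof.
transitivity (\esum_(y in iter k f @^-1` [set x])
    \esum_(z in iter n f @^-1` [set y])
      (expR (birkhoff_sum f phi k y + birkhoff_sum f phi n z))%:E)%E;
    last first.
  apply: eq_esum => y _; rewrite -esumZ ?expR_gt0//.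
  by apply: eq_esum => z _; rewrite expRD EFinM.
rewrite esum_esum//.
rewrite /fiber_sum (reindex_esum (iter (n + k) f @^-1` [set x]) _
    (fun z => (iter n f z, z))); last first.
  split=> /=.
  - by move=> z /= <-; split=> //=; rewrite addnC iterD.
  - by move=> z z' _ _ [].
  - by move=> [y z] [/= yx zy]; exists z; rewrite /= ?zy// addnC iterD zy.
by apply: eq_esum => z _; rewrite /= birkhoff_sumD addrC.
Qed.

Lemma fiber_sumD_ge f phi n k x (a : R) : 0 < a ->
  (forall y, (a%:E <= fiber_sum f phi n y)%E) ->
  (a%:E * fiber_sum f phi k x <= fiber_sum f phi (n + k) x)%E.
Proof.
move=> a0 h; rewrite fiber_sumD [X in (_ * X)%E]/fiber_sum -esumZ//.
by apply: le_esum => y _; rewrite muleC lee_wpmul2l// lee_fin expR_ge0.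
Qed.

Lemma fiber_sumD_le f phi n k x (b : R) : 0 < b ->
  (forall y, (fiber_sum f phi n y <= b%:E)%E) ->
  (fiber_sum f phi (n + k) x <= b%:E * fiber_sum f phi k x)%E.
Proof.
move=> b0 h; rewrite fiber_sumD [X in (_ <= _ * X)%E]/fiber_sum -esumZ//.
by apply: le_esum => y _; rewrite [leRHS]muleC lee_wpmul2l// lee_fin expR_ge0.
Qed.

Lemma fiber_sum0 f phi x : fiber_sum f phi 0 x = 1%E.
Proof.
rewrite /fiber_sum [X in esum X _](_ : _ = [set x]) ?esum_set1//.
by rewrite /birkhoff_sum big_ord0 expR0.
Qed.

Lemma injective_at_scale_iter f e n x y : injective_at_scale e f ->
  (forall j, (j < n)%N -> mdist (iter j f x) (iter j f y) < e) ->
  iter n f x = iter n f y -> x = y.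
Proof.
move=> finj; elim: n => [//|n IHn] h /= fxy; apply: IHn.
  by move=> j jn; apply: h; apply: ltnW.
by apply: finj => //; apply: h.
Qed.

(** A renewal inequality: the preimages lying in [V i] inject, under [t i] steps, into the preimages
    of order [k - t i]. With small balls and time 1 it gives a crude exponential bound; with dynamic
    balls of varying length it ties fibre sums to pressure. *)
Lemma fiber_sum_cover f phi (S : choiceType) (s : seq S) (V : S -> set M)
    (t : S -> nat) (r : S -> R) k x :
  (forall y, exists2 i, i \in s & V i y) ->
  (forall i, i \in s -> (t i <= k)%N) ->
  (forall i y, i \in s -> V i y -> birkhoff_sum f phi (t i) y <= r i) ->
  (forall i y z, i \in s -> V i y -> V i z ->
     iter (t i) f y = iter (t i) f z -> y = z) ->
  (fiber_sum f phi k x <=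
   \sum_(i <- s) ((expR (r i))%:E * fiber_sum f phi (k - t i) x))%E.
Proof.
move=> cov tk rV inj.
apply: le_trans.
  apply: (@esum_le_cover _ _ _ s _ V) => [y _|y _]; last exact: cov.
  by rewrite lee_fin expR_ge0.
rewrite big_seq [leRHS]big_seq; apply: lee_sum => i si.
rewrite /fiber_sum -esumZ ?expR_gt0//.
apply: (esum_le_rel (r := fun y z => V i y /\ z = iter (t i) f y)).
- by move=> z _; rewrite -EFinM lee_fin mulr_ge0 ?expR_ge0.
- move=> y [/= yx Vy]; exists (iter (t i) f y); split=> //.
    by rewrite -iterD subnK ?tk.
  rewrite -EFinM lee_fin -expRD ler_expR -{1}(subnKC (tk _ si)) birkhoff_sumD.
  by rewrite lerD2r rV.
- by move=> y y' z _ _ [Vy ->] [Vy' e]; exact: (inj i).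
Qed.

Lemma fiber_sum_growth f phi e (B : R) : compact [set: M] -> 0 < e ->
  injective_at_scale e f -> (forall x, `|phi x| <= B) ->
  exists2 D : R, 0 < D &
    forall n x, (fiber_sum f phi n x <= (D ^+ n)%:E)%E.
Proof.
move=> cM e0 finj phiB.
have [//||D _ cov] := @finite_subcover M M [set: M] [set: M]
    (fun x => ball x (e / 2)).
  by move=> x _; exists x => //; apply: nbhsx_ballx; rewrite divr_gt0.
(* Each point has at most one preimage in each of the balls, hence at most [size D] of them. The
   [+ 1] keeps [d] positive when the cover is empty. *)
pose d : R := (size D)%:R * expR B + 1.
have d0 : 0 < d by rewrite ltr_wpDl// mulr_ge0 ?expR_ge0.
exists d => //; elim=> [|n IHn] x; first by rewrite fiber_sum0 expr0.
apply: le_trans.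
  apply: (@fiber_sum_cover f phi M D (fun x => ball x (e / 2))
            (fun=> 1%N) (fun=> B)).
  - by move=> y; exact: cov.
  - by [].
  - move=> i y _ _; rewrite (le_trans (ler_norm _))//.
    by rewrite (le_trans (birkhoff_sum_bound _ _ _ phiB))// mul1r.
  - move=> i y z _; rewrite !ballEmdist/= => iy iz; apply: finj.
    rewrite (le_lt_trans (metric_triangle _ i _))// (splitr e) ltrD//.
    by rewrite metric_sym.
rewrite exprS.
apply: (@le_trans _ _ (\sum_(i <- D) (expR B * d ^+ n)%:E)%E).
  by apply: lee_sum => i _; rewrite subSS subn0 EFinM lee_wpmul2l ?lee_fin ?expR_ge0.
rewrite sumEFin lee_fin big_const_seq count_predT iter_addr_0.
rewrite -mulr_natl mulrA ler_wpM2r ?exprn_ge0 ?ltW//.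
by rewrite /d ltrDl.
Qed.

End Fibers.

(** * Pressure and growth of fibre sums *)

Lemma expR_growth_le (R : realType) (c C s t : R) : 0 < c ->
  (forall k : nat, c * expR (k%:R * s) <= C * expR (k%:R * t)) -> s <= t.
Proof.
move=> c0 h; rewrite leNgt; apply/negP => ts.
have d0 : 0 < s - t by rewrite subr_gt0.
have hk (k : nat) : c * (k%:R * (s - t)) <= C.
  have := h k; rewrite -ler_pdivrMr ?expR_gt0// -mulrA -expRN -expRD -mulrBr.
  by apply: le_trans; rewrite ler_pM2l// (le_trans _ (expR_ge1Dx _))// lerDr.
have := hk (Num.truncn (C / (c * (s - t)))).+1.
rewrite mulrCA -ler_pdivlMr ?mulr_gt0// leNgt => /negP; apply.
by have := truncnS_gt (C / (c * (s - t))).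
Qed.

Section PressureBounds.
Context {R : realType} {M : metricType R} (f : M -> M) (phi : M -> R) (B : R).
Hypothesis phiB : forall x, `|phi x| <= B.

Lemma dyn_ball_center (d : R) x n : 0 < d -> dyn_ball f d x n x.
Proof. by move=> d0 j _; rewrite mdistxx. Qed.

Lemma birkhoff_le_sup (d : R) x n y : dyn_ball f d x n y ->
  birkhoff_sum f phi n y <= sup_birkhoff f phi n d x.
Proof.
move=> dy; apply: ub_le_sup; last by exists y.
exists (n%:R * B) => _ [z _ <-].
by rewrite (le_trans (ler_norm _))// birkhoff_sum_bound.
Qed.

Lemma sup_birkhoff_le (d w : R) x n : 0 < d ->
  (forall y z, mdist y z < d -> `|phi y - phi z| <= w) ->
  sup_birkhoff f phi n d x <= birkhoff_sum f phi n x + n%:R * w.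
Proof.
move=> d0 mod; apply: ge_sup.
  by exists (birkhoff_sum f phi n x); exists x => //; exact: dyn_ball_center.
move=> _ [y dy <-].
have /ler_normlP[_] : `|birkhoff_sum f phi n y - birkhoff_sum f phi n x| <= n%:R * w.
  apply: birkhoff_sum_close => j jn; apply: mod; rewrite metric_sym.
  by apply: dy; exact: ltnW.
by rewrite lerBlDl.
Qed.

Lemma dyn_covers_anti Lambda d N N' : (N <= N')%N ->
  dyn_covers f Lambda d N' `<=` dyn_covers f Lambda d N.
Proof.
by move=> NN' U [cU U2 cov]; split=> // u /U2; exact: leq_trans.
Qed.

Lemma pressure_sum_nondecreasing Lambda d g :
  nondecreasing_seq (fun N => pressure_sum f phi Lambda d N g).
Proof.
move=> N N' NN'; apply: ereal_inf_le_tmp => _ [U UN <-].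
by exists U => //; exact: (dyn_covers_anti NN').
Qed.

Lemma pressure_sum_le_measure Lambda d N g :
  (pressure_sum f phi Lambda d N g <= pressure_measure f phi Lambda d g)%E.
Proof.
apply: lime_ge.
  by apply: ereal_nondecreasing_is_cvgn; exact: pressure_sum_nondecreasing.
by exists N => // k /= Nk; exact: pressure_sum_nondecreasing.
Qed.

Lemma pressure_sum_ge0 Lambda d N g : (0 <= pressure_sum f phi Lambda d N g)%E.
Proof.
apply: le_ereal_inf_tmp => _ [U _ <-].
by apply: esum_ge0 => u _; rewrite lee_fin expR_ge0.
Qed.

(** A finite subcover of total weight at most 1 at exponent [g] turns [fiber_sum_cover] into a
    recursion for A_k that preserves the bound C exp(k g). Strong induction then needs [C] only to
    dominate the orders below the longest ball. *)
Lemma fiber_sum_le_pressure (e d g0 : R) : compact [set: M] -> continuous f ->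
  injective_at_scale e f -> 0 < d -> d + d <= e ->
  (pressure_scale f phi setT d < g0%:E)%E ->
  exists2 C : R, 0 <= C &
    forall k x, (fiber_sum f phi k x <= (C * expR (k%:R * g0))%:E)%E.
Proof.
move=> cM cf finj d0 de /ereal_inf_lt[_ [g gmeas <-]]; rewrite lte_fin => gg0.
have [D D0 Dbnd] := fiber_sum_growth cM (lt_le_trans (addr_gt0 d0 d0) de) finj phiB.
(* Balls of length at least 1 are asked for so that the recursion strictly lowers the order. *)
have : (pressure_sum f phi setT d 1 g < 1)%E.
  by rewrite (le_lt_trans (pressure_sum_le_measure _ _ _ _))// gmeas.
move=> /ereal_inf_lt[_ [U [cU U1 Ucov] <-] Ult].
have [|s [us sU] cov] := @finite_subcover M (M * nat)%type [set: M] U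
    (fun u => dyn_ball f d u.1 u.2) cM.
  move=> y _; have [u Uu yu] := Ucov y Logic.I; exists u => //.
  (* Dynamic balls are open, so the countable cover has a finite subcover. *)
  have : \forall z \near y, forall j, (j < u.2.+1)%N -> mdist (iter j f u.1) (iter j f z) < d.
    have {yu} : forall j, (j < u.2.+1)%N ->
      mdist (iter j f u.1) (iter j f y) < d by exact: yu.
    elim: u.2.+1 => [|m IHm] hj; first by apply: nearW.
    have hm := hj m (ltnSn m).
    have fm : {for y, continuous (iter m f)}.
      elim: m {IHm hj hm} => [|m IHm]; first exact: cvg_id.
      by apply: (@continuous_comp _ _ _ (iter m f) f) => //; exact: cf.
    near=> z => j; rewrite ltnS leq_eqVlt => /predU1P[->|].
      near: z; have : nbhs (iter m f y) (ball (iter m f u.1) d).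
        apply/nbhs_ballP; exists (d - mdist (iter m f u.1) (iter m f y)).
          by rewrite /= subr_gt0.
        move=> z; rewrite !ballEmdist/= => h.
        by rewrite (le_lt_trans (metric_triangle _ (iter m f y) _))// -ltrBrDl.
      by rewrite ballEmdist => /fm.
    move: j; near: z; apply: IHm => j jm; apply: hj; exact: ltnW.
  by apply: filterS => z h j ju; apply: h.
pose w (u : M * nat) : R := expR (- g * u.2%:R + sup_birkhoff f phi u.2 d u.1).
have w1 : \sum_(u <- s) w u <= 1.
  rewrite -lee_fin -sumEFin (le_trans _ (ltW Ult))//.
  apply: esum_ge; exists [set` s].
    by split; [exact: finite_seq|move=> u /sU].
  by rewrite -fsbig_seq.
pose m := \max_(u <- s) u.2.
have sm u : u \in s -> (u.2 <= m)%N by move=> us'; exact: leq_bigmax_seq.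
(* Each term dominates A_k exp(- g k) for one order k < m, by the crude bound [D ^+ k]. *)
pose C := \sum_(k < m) D ^+ k * expR (- g * k%:R).
have D_ge0 k : 0 <= D ^+ k * expR (- g * k%:R).
  by rewrite mulr_ge0 ?expR_ge0// exprn_ge0 ?ltW.
have C0 : 0 <= C by apply: sumr_ge0.
have main k x : (fiber_sum f phi k x <= (C * expR (k%:R * g))%:E)%E.
  elim/ltn_ind: k x => k IHk x.
  have [km|mk] := ltnP k m.
    rewrite (le_trans (Dbnd k x))// lee_fin -ler_pdivrMr ?expR_gt0// -expRN.
    rewrite /C (bigD1 (Ordinal km))//= mulrC [k%:R * g]mulrC -mulNr mulrC lerDl.
    by apply: sumr_ge0.
  apply: le_trans.
    apply: (@fiber_sum_cover _ _ f phi _ s (fun u => dyn_ball f d u.1 u.2)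
       (fun u => u.2) (fun u => sup_birkhoff f phi u.2 d u.1)).
    - by move=> y; exact: cov.
    - by move=> u /sm um; exact: leq_trans mk.
    - by move=> u y _; exact: birkhoff_le_sup.
    - move=> u y z _ uy uz; apply: (injective_at_scale_iter finj) => j ju.
      rewrite (le_lt_trans (metric_triangle _ (iter j f u.1) _))//.
      rewrite (lt_le_trans _ de)// ltrD//.
        by rewrite metric_sym; apply: uy; exact: ltnW.
      by apply: uz; exact: ltnW.
  apply: (@le_trans _ _ (\sum_(u <- s) (w u * (C * expR (k%:R * g)))%:E)%E).
    rewrite big_seq [leRHS]big_seq; apply: lee_sum => u us'.
    have u0 : (0 < u.2)%N by apply: U1; exact: sU.
    have uk : (u.2 <= k)%N by apply: leq_trans mk; exact: sm.
    apply: (@le_trans _ _ ((expR (sup_birkhoff f phi u.2 d u.1))%:E *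
        (C * expR ((k - u.2)%:R * g))%:E)%E).
      apply: lee_wpmul2l; first by rewrite lee_fin expR_ge0.
      by apply: IHk; rewrite ltn_subrL u0 (leq_trans u0).
    rewrite -EFinM lee_fin mulrCA [leRHS]mulrCA ler_wpM2l// -!expRD ler_expR.
    by rewrite natrB// mulrBl; lra.
  by rewrite sumEFin lee_fin -mulr_suml ler_piMl// mulr_ge0 ?expR_ge0.
exists C => // k x; rewrite (le_trans (main k x))// lee_fin ler_wpM2l// ler_expR.
by rewrite ler_wpM2l// ltW.
Unshelve. all: by end_near. Qed.

End PressureBounds.

(** * Upper bounds on pressure from fibre sums *)

Section PressureUpper.
Context {R : realType} {M : metricType R} (f : M -> M) (phi : M -> R) (B : R).
Hypothesis phiB : forall x, `|phi x| <= B.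

(** [Lambda] is covered by balls of length [n] centred at preimages, of orders [n] to [n + m], of
    one base point per [n]. Their total weight is at most a constant times exp(n (th + w - g)), the
    tail of a convergent geometric series. *)
Lemma pressure_measure_eq0 (Lambda : set M) (d d' w th C g : R) (m : nat) :
  0 < d -> (forall y z, mdist y z < d -> `|phi y - phi z| <= w) ->
  (forall n x, countable (iter n f @^-1` [set x])) ->
  (forall x, exists y, f y = x) ->
  (forall x N, Lambda x -> exists2 n, (N <= n)%N &
     forall q, mdist (iter n f x) q < d' ->
       exists2 y, iter n f y = q & dyn_ball f d y n x) ->
  (forall x u, exists k y, [/\ (k <= m)%N, iter k f y = x & mdist u y < d']) ->
  0 <= C -> (forall n, exists x, (fiber_sum f phi n x <= (C * expR (n%:R * th))%:E)%E) ->
  th + w < g -> pressure_measure f phi Lambda d g = 0%E.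
Proof.
move=> d0 mod cfib fsurj shadow dense C0 growth thg.
(* The base point for length [n] is taken at order [n + m], to which all the levels from [n] to
   [n + m] are lifted below. *)
have [xs xsP] : {xs : nat -> M & forall n,
    (fiber_sum f phi (n + m) (xs n) <= (C * expR ((n + m)%:R * th))%:E)%E}.
  exact: (@choice nat M (fun n x =>
    (fiber_sum f phi (n + m) x <= (C * expR ((n + m)%:R * th))%:E)%E)).
have surj k x : exists y, iter k f y = x.
  elim: k x => [|k IHk] x; first by exists x.
  by have [y <-] := fsurj x; have [z <-] := IHk y; exists z.
pose J n := [set y | exists2 k, (k <= m)%N & iter (n + k) f y = xs n].
(* One factor for the number of levels, one for the at most [m] additional terms of the Birkhoff
   sum, one for the growth bound over [m] more steps. *)
pose K := (m.+1)%:R * (expR (m%:R * B) * (C * expR (m%:R * th))).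
pose q := expR (th + w - g).
have q0 : 0 < q by exact: expR_gt0.
have q1 : q < 1 by rewrite -expR0 ltr_expR subr_lt0.
have K0 : 0 <= K by rewrite !mulr_ge0 ?expR_ge0.
pose a n y := (expR (- g * n%:R + (birkhoff_sum f phi n y + n%:R * w)))%:E.
have Jsum n : (\esum_(y in J n) a n y <= (K * q ^+ n)%:E)%E.
  apply: le_trans.
    apply: (@esum_le_cover _ _ _ (iota 0 m.+1) _
        (fun k => iter (n + k) f @^-1` [set xs n])) => [y _|y [k km yk]].
      by rewrite lee_fin expR_ge0.
    by exists k => //; rewrite mem_iota.
  pose b := expR (- g * n%:R + n%:R * w + m%:R * B).
  apply: (@le_trans _ _ (\sum_(k <- iota 0 m.+1)
      (b * (C * expR ((n + m)%:R * th)))%:E)%E).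
    rewrite big_seq [leRHS]big_seq; apply: lee_sum => k.
    rewrite mem_iota/= add0n ltnS => km.
    apply: (@le_trans _ _ (b%:E * fiber_sum f phi (n + m) (xs n))%E); last first.
      by rewrite EFinM lee_wpmul2l// lee_fin expR_ge0.
    rewrite /fiber_sum -esumZ ?expR_gt0//.
    (* A centre [y] at level [k] is lifted by surjectivity to some [z] of order [n + m]. The orbit
       of [z] runs [m - k] steps to [y], then [n] steps, then [k] steps, so the two weights differ
       by at most exp(m B). *)
    apply: (esum_le_rel (r := fun y z => iter (m - k) f z = y)) => //.
    - by move=> z _; rewrite -EFinM lee_fin mulr_ge0 ?expR_ge0.
    - move=> y [_ /= yx]; have [z zy] := surj (m - k)%N y; exists z; split => //.
        by rewrite /= -yx -zy -iterD -addnA (subnKC km).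
      rewrite -EFinM lee_fin -expRD ler_expR.
      rewrite -{2}(subnK km) addnC -[(m - k + k + n)%N]addnA birkhoff_sumD zy addnC birkhoff_sumD.
      have /ler_normlP[h1 _] := birkhoff_sum_bound f (m - k) z phiB.
      have /ler_normlP[h2 _] := birkhoff_sum_bound f k (iter n f y) phiB.
      have : (m - k)%:R * B + k%:R * B = m%:R * B by rewrite -mulrDl -natrD subnK.
      by move: h1 h2; lra.
    - by move=> y y' z _ _ -> ->.
  rewrite sumEFin lee_fin big_const_seq count_predT size_iota iter_addr_0.
  have E : b * expR ((n + m)%:R * th) =
      expR (m%:R * B) * expR (m%:R * th) * q ^+ n.
    by rewrite /b /q -expRM_natl -!expRD natrD -mulr_natl; congr expR; ring.
  rewrite [b * (C * _)]mulrCA E /K -[leLHS]mulr_natl.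
  by rewrite le_eqVlt; apply/orP; left; apply/eqP; ring.
have sumle N : (pressure_sum f phi Lambda d N g <=
    (K * q ^+ N * (1 - q)^-1)%:E)%E.
  pose U := [set u : M * nat | (N <= u.2)%N /\ J u.2 u.1].
  apply: (@le_trans _ _ (\esum_(u in U)
      (expR (- g * u.2%:R + sup_birkhoff f phi u.2 d u.1))%:E)%E).
    apply: ereal_inf_lbound; exists U => //; split.
    - apply: (@sub_countable _ _ _ (\bigcup_n \bigcup_k
          ((fun y => (y, n)) @` (iter (n + k) f @^-1` [set xs n])))).
        apply: subset_card_le => -[y n] [/= _ [k _ yk]].
        by exists n => //; exists k => //; exists y.
      apply: bigcup_countable => // n _; apply: bigcup_countable => // k _.
      by apply: (sub_countable (card_image_le _ _)).
    - by move=> u [].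
    - move=> x /(shadow _ N)[n Nn hn].
      (* A preimage of the base point close to the n-th image of [x] is pulled back along the orbit
         of [x] to a centre whose ball contains [x]. *)
      have [k [y [km yx yd]]] := dense (xs n) (iter n f x).
      have [z zy zx] := hn _ yd.
      exists (z, n) => //; split => //=; exists k => //.
      by rewrite addnC iterD zy.
  apply: (@le_trans _ _ (\esum_(n in [set n | (N <= n)%N])
      \esum_(y in J n) a n y)%E); last first.
    apply: (@le_trans _ _ (\esum_(n in [set n | (N <= n)%N]) (K * q ^+ n)%:E)%E).
      exact: le_esum.
    exact: esum_geometric_tail.
  rewrite esum_esum; last by move=> n y _ _; rewrite lee_fin expR_ge0.
  apply: (esum_le_rel (r := fun u v => u = (v.2, v.1))) => //.
  - by move=> v _; rewrite lee_fin expR_ge0.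
  - move=> [y n] [/= Nn Jy]; exists (n, y); split=> //=.
    by rewrite lee_fin ler_expR lerD2l sup_birkhoff_le.
  - by move=> u u' v _ _ -> ->.
apply: cvg_lim => //.
apply: (@squeeze_cvge _ _ _ _ (fun=> 0%E) _ (fun N => (K * q ^+ N * (1 - q)^-1)%:E)).
- by apply: nearW => N; rewrite pressure_sum_ge0//= sumle.
- exact: cvg_cst.
- apply: cvg_EFin; first by apply: nearW.
  rewrite -[X in _ --> X](mul0r (1 - q)^-1).
  apply: cvgMr_tmp; have := @cvg_geometric R K q; rewrite /geometric/=; apply.
  by rewrite ger0_norm// ltW.
Qed.

Lemma pressure_scale_le (Lambda : set M) (d d' w th C : R) (m : nat) :
  0 < d -> (forall y z, mdist y z < d -> `|phi y - phi z| <= w) ->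
  (forall n x, countable (iter n f @^-1` [set x])) ->
  (forall x, exists y, f y = x) ->
  (forall x N, Lambda x -> exists2 n, (N <= n)%N &
     forall q, mdist (iter n f x) q < d' ->
       exists2 y, iter n f y = q & dyn_ball f d y n x) ->
  (forall x u, exists k y, [/\ (k <= m)%N, iter k f y = x & mdist u y < d']) ->
  0 <= C -> (forall n, exists x, (fiber_sum f phi n x <= (C * expR (n%:R * th))%:E)%E) ->
  (pressure_scale f phi Lambda d <= (th + w)%:E)%E.
Proof.
move=> d0 mod cfib fsurj shadow dense C0 growth.
apply/lee_addgt0Pr => e e0; apply: ereal_inf_lbound; exists (th + w + e) => //=.
by apply: (pressure_measure_eq0 d0 mod cfib fsurj shadow dense C0 growth); rewrite ltrDl.
Qed.

(** A cover at scale [d'] becomes one at scale [d] by enlarging the balls; the supremum over a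
    larger ball of length n costs at most n w, which a shift of the exponent by [w] absorbs. *)
Lemma pressure_scale_mono (Lambda : set M) (d d' w : R) :
  0 < d' -> d' <= d -> (forall y z, mdist y z < d -> `|phi y - phi z| <= w) ->
  (pressure_scale f phi Lambda d <= pressure_scale f phi Lambda d' + w%:E)%E.
Proof.
move=> d'0 d'd mod; rewrite -leeBlDr//.
apply: le_ereal_inf_tmp => _ [g + <-]; rewrite /mkset => g0; rewrite leeBlDr// -EFinD.
apply: ereal_inf_lbound; exists (g + w); last by [].
rewrite /mkset; apply: cvg_lim => //; rewrite -[X in _ --> X]g0.
have le N : (pressure_sum f phi Lambda d N (g + w) <= pressure_sum f phi Lambda d' N g)%E.
  apply: le_ereal_inf_tmp => _ [U [cU UN Ucov] <-].
  apply: (@le_trans _ _ (\esum_(u in U)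
      (expR (- (g + w) * u.2%:R + sup_birkhoff f phi u.2 d u.1))%:E)%E).
    apply: ereal_inf_lbound; exists U => //; split=> // x /Ucov[u Uu xu].
    by exists u => // j /xu h; exact: lt_le_trans d'd.
  apply: le_esum => u _; rewrite lee_fin ler_expR.
  have h1 := sup_birkhoff_le f u.1 u.2 (lt_le_trans d'0 d'd) mod.
  have h2 := birkhoff_le_sup phiB (@dyn_ball_center _ _ f d' u.1 u.2 d'0).
  by move: h1 h2; rewrite [_ * w]mulrC; lra.
apply: (@squeeze_cvge _ _ _ _ (fun=> 0%E) _ (fun N => pressure_sum f phi Lambda d' N g)).
- by apply: nearW => N; rewrite pressure_sum_ge0//= le.
- by rewrite g0; exact: cvg_cst.
- apply: ereal_nondecreasing_is_cvgn.
  exact: pressure_sum_nondecreasing.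
Qed.

End PressureUpper.

(** The [lim] in [relative_pressure] has meaning only once convergence is known. The limit is the
    limsup: when [P] exceeds a + w at one small scale, it stays above a at all smaller ones. *)
Lemma almost_nonincreasing_at_right0_is_cvge (R : realType) (P : R -> \bar R) :
  (forall w : R, 0 < w -> exists2 d0 : R, 0 < d0 & forall d d' : R,
     0 < d' -> d' <= d -> d < d0 -> (P d <= P d' + w%:E)%E) ->
  cvg (P d @[d --> 0^'+]).
Proof.
move=> mono; pose L := limf_esup P 0^'+.
have lowL (a : R) : (a%:E < L)%E -> \forall d \near 0^'+, (a%:E < P d)%E.
  move=> aL; have [w w0 awL] : exists2 w, 0 < w & ((a + w)%:E < L)%E.
    case: L aL => [l| |]; rewrite ?lte_fin.
    - by move=> al; exists ((l - a) / 2); rewrite ?lte_fin; lra.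
    - by move=> _; exists 1 => //; exact: ltry.
    - by rewrite ltNge leNye.
  have [d0 d00 hd] := mono w w0.
  pose V : set R := [set d | 0 < d < d0].
  have : (L <= ereal_sup (P @` V))%E.
    apply: ereal_inf_lbound; exists V => //.
    by near=> d; apply/andP; split; near: d; [exact: nbhs_right_gt|exact: nbhs_right_lt].
  move=> /(lt_le_trans awL)/ereal_sup_gt[_ [d1 /= /andP[d10 d1d] <-] hP].
  near=> d.
  have dpos : 0 < d by near: d; exact: nbhs_right_gt.
  have dd1 : d <= d1 by near: d; exact: nbhs_right_le.
  rewrite -(@lteD2rE _ w%:E)// -EFinD.
  exact: lt_le_trans hP (hd d1 d dpos dd1 d1d).
have upL (b : R) : (L < b%:E)%E -> \forall d \near 0^'+, (P d < b%:E)%E.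
  move=> /ereal_inf_lt[_ [V FV <-] hV].
  apply: filterS FV => d Vd; apply: le_lt_trans hV.
  by apply: ereal_sup_ubound; exists d.
apply/cvg_ex; exists L; case: L lowL upL => [l| |] lowL upL.
- have e (w : R) : 0 < w ->
      \forall d \near 0^'+, ((l - w)%:E < P d)%E /\ (P d < (l + w)%:E)%E.
    move=> w0; near=> d; split; near: d; [apply: lowL|apply: upL];
      rewrite lte_fin; lra.
  apply: cvg_EFin.
    have := e 1 ltr01; apply: filterS => d; case: (P d) => [r| |]//= [h1 h2].
      by move: h2; rewrite ltNge leey.
    by move: h1; rewrite ltNge leNye.
  apply/cvgrPdist_lt => /= w w0; have := e w w0.
  apply: filterS => d /=; case: (P d) => [r| |]//= [h1 h2].
  + by move: h1 h2; rewrite !lte_fin ltr_distlC => -> ->.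
  + by move: h2; rewrite ltNge leey.
  + by move: h1; rewrite ltNge leNye.
- by apply/cvgeyPgtr => A _; apply: lowL; exact: ltry.
- by apply/cvgeNyPltr => A _; apply: upL; exact: ltNyr.
Unshelve. all: by end_near. Qed.

Section RelativePressure.
Context {R : realType} {M : metricType R} (f : M -> M) (phi : M -> R).
Hypotheses (cM : compact [set: M]) (cphi : continuous phi).

Lemma compact_bounded_fun : exists B, forall x, `|phi x| <= B.
Proof.
have /compact_bounded [B [_ hB]] : compact (phi @` [set: M]).
  by apply: continuous_compact => //; exact: continuous_subspaceT.
by exists (B + 1) => x; apply: (hB (B + 1)); [rewrite ltrDl|exists x].
Qed.

Lemma compact_uniform_modulus (w : R) : 0 < w ->
  exists2 d, 0 < d & forall x y, mdist x y < d -> `|phi x - phi y| <= w.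
Proof.
move=> w0; have [d /= d0 hd] : \forall d \near 0^'+,
    [set: M] `<=` (fun x => forall y, mdist x y < d -> `|phi x - phi y| <= w).
  apply: (iffLR (compact_near_coveringP [set: M])) cM R 0^'+
    (fun d x => forall y, mdist x y < d -> `|phi x - phi y| <= w) _ _ => x _.
  have /nbhs_ballP[e /= e0 he] : nbhs x [set z | `|phi x - phi z| < w / 2].
    by have /cvgrPdist_lt := @cphi x; apply; lra.
  exists (ball x (e / 2), [set d | d < e / 2]); first split => /=.
  - by apply: nbhsx_ballx; lra.
  - by apply: nbhs_right_lt; lra.
  move=> [z d] [/= xz de] y zy.
  have h1 : `|phi x - phi z| < w / 2 by apply: he; apply: le_ball xz; lra.
  have h2 : `|phi x - phi y| < w / 2.
    apply: he; rewrite ballEmdist/=; move: xz; rewrite ballEmdist/= => xz.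
    have := metric_triangle x z y; lra.
  rewrite [w]splitr -(subrK (phi x) (phi z)) -addrA.
  rewrite (le_trans (ler_normD _ _))// distrC; lra.
exists (d / 2); first by lra.
by move=> x y; apply: (hd (d / 2)) => //=; rewrite ?sub0r ?normrN ?ger0_norm; lra.
Qed.

Lemma pressure_scale_is_cvg Lambda : cvg (pressure_scale f phi Lambda d @[d --> 0^'+]).
Proof.
apply: almost_nonincreasing_at_right0_is_cvge => w w0.
have [B phiB] := compact_bounded_fun.
have [d0 d00 hd] := compact_uniform_modulus w0.
exists d0 => // d d' d'0 d'd dd0; apply: (pressure_scale_mono f phiB) => //.
by move=> y z yz; apply: hd; exact: lt_trans dd0.
Qed.

End RelativePressure.

(** * Maps with a uniform local inverse *)

Section ScaledDynamics.
Context {R : realType} {M : metricType R}.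
Implicit Types (f : M -> M) (phi : M -> R) (S : set M).

Definition uniformly_open f := forall e : R, 0 < e -> exists2 d, 0 < d &
  forall x z, mdist (f x) z < d -> exists2 y, mdist x y < e & f y = z.

(** This is all that the pressure estimates retain of expansion. Because [d'] is chosen before [x]
    and [n], a single bound on the order of the approximating preimages serves every point of
    [S]. *)
Definition backward_shadowed f S := forall d : R, 0 < d -> exists2 d', 0 < d' &
  forall x N, S x -> exists2 n, (N <= n)%N &
    forall q, mdist (iter n f x) q < d' ->
      exists2 y, iter n f y = q & dyn_ball f d y n x.

Lemma uniformly_open_iter f k : uniformly_open f -> uniformly_open (iter k f).
Proof.
move=> fop; elim: k => [|k IHk] e e0; first by exists e => // x z xz; exists z.
have [d d0 hd] := IHk e e0; have [d' d'0 hd'] := fop d d0.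
exists d' => // x z xz; have [y xy yz] := hd' _ _ xz.
by have [w xw wy] := hd _ _ xy; exists w => //=; rewrite wy.
Qed.

(** A point without preimages would be its whole backward orbit, so density would reduce M to that
    point, which is then its own image. *)
Lemma dense_preimages_surj f : dense_preimages f -> forall x, exists y, f y = x.
Proof.
move=> fd x; apply/not_existsP => nx.
have M1 y : y = x.
  apply: contrapT => yx; have [] := fd x (~` [set x]).
  - by exists y.
  - apply: closed_openC; apply: accessible_closed_set1.
    exact/hausdorff_accessible/metric_hausdorff.
  - by move=> z [/= zx [[_ /= /zx//|m _ /= fz]]]; exact: (nx (iter m f z)).
by apply: (nx x); exact: M1.
Qed.

Lemma countable_fiber f e n x : compact [set: M] -> 0 < e ->
  injective_at_scale e f -> countable (iter n f @^-1` [set x]).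
Proof.
move=> cM e0 finj.
have [//||D _ cov] := @finite_subcover M M [set: M] [set: M]
    (fun x => ball x (e / 2)).
  by move=> y _; exists y => //; apply: nbhsx_ballx; rewrite divr_gt0.
have c1 y : countable (f @^-1` [set y]).
  apply: (@sub_countable _ _ _ (\bigcup_(i in [set` D])
      (f @^-1` [set y] `&` ball i (e / 2)))).
    by apply: subset_card_le => z fz; have [i Di zi] := cov z Logic.I; exists i.
  apply: bigcup_countable; first exact/finite_set_countable/finite_seq.
  move=> i _; have [->|/set0P[z [fz iz]]] := eqVneq (f @^-1` [set y] `&` ball i (e / 2)) set0.
    exact: countable0.
  apply: (@sub_countable _ _ _ [set z]); last exact: countable1.
  apply: subset_card_le => w [fw iw]; apply: finj; last by rewrite fw.
  move: iz iw; rewrite !ballEmdist/= => iz iw.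
  rewrite (le_lt_trans (metric_triangle _ i _))// (splitr e) ltrD//.
  by rewrite metric_sym.
elim: n => [|n IHn]; first exact: countable1.
apply: (@sub_countable _ _ _ (\bigcup_(y in f @^-1` [set x])
    (iter n f @^-1` [set y]))).
  by apply: subset_card_le => z /= fz; exists (iter n f z).
apply: bigcup_countable => // y _.
elim: n y {IHn} => [|n IHn] y; first exact: countable1.
apply: (@sub_countable _ _ _ (\bigcup_(z in f @^-1` [set y])
    (iter n f @^-1` [set z]))).
  by apply: subset_card_le => z /= fz; exists (iter n f z).
by apply: bigcup_countable => // z _.
Qed.

(** Uniform openness of an iterate lets a preimage follow its base point, so the order found for one
    pair (x, u) works near that pair; compactness of M x M bounds the order. *)
Lemma dense_preimages_uniform f (d : R) : compact [set: M] -> uniformly_open f ->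
  dense_preimages f -> 0 < d ->
  exists m, forall x u, exists k y,
    [/\ (k <= m)%N, iter k f y = x & mdist u y < d].
Proof.
move=> cM fop fd d0.
have cMM := compact_setX cM cM.
have [N _ hN] : \forall m \near \oo, [set: M] `*` [set: M] `<=` (fun p =>
    exists k y, [/\ (k <= m)%N, iter k f y = p.1 & mdist p.2 y < d]).
  apply: (iffLR (compact_near_coveringP _) cMM nat \oo (fun m p =>
    exists k y, [/\ (k <= m)%N, iter k f y = p.1 & mdist p.2 y < d])) => -[x u] _.
  have d30 : 0 < d / 3 by rewrite divr_gt0.
  have [y [uy [k _ /= yx]]] : (ball u (d / 3))^° `&` \bigcup_m (iter m f @^-1` [set x]) !=set0.
    apply: fd; last exact: open_interior.
    by exists u; apply: nbhsx_ballx.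
  have {}uy : mdist u y < d / 3 by move/interior_subset: uy; rewrite ballEmdist.
  have [e e0 he] := uniformly_open_iter k fop d30.
  exists (ball x e `*` ball u (d / 3), [set m | (k <= m)%N]); first split => /=.
  - by exists (ball x e, ball u (d / 3)) => //=; split; exact: nbhsx_ballx.
  - exact: nbhs_infty_ge.
  move=> [[x' u'] m] [/= [xx' uu'] km]; move: xx' uu'; rewrite !ballEmdist/= => xx' uu'.
  have [y' yy' y'x] := he y x' (eq_ind_r (fun z => mdist z x' < e) xx' yx).
  exists k, y'; split=> //.
  have := metric_triangle u' u y'; have := metric_triangle u y y'.
  by rewrite (metric_sym u' u); lra.
by exists N => x u; have := hN N (leqnn N) (x, u); apply.
Qed.

End ScaledDynamics.

(** * Exponential growth of fibre sums against pressure *)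

Section GrowthPressure.
Context {R : realType} {M : metricType R} (f : M -> M) (phi : M -> R) (e : R).
Hypotheses (cM : compact [set: M]) (cf : continuous f) (cphi : continuous phi).
Hypotheses (e0 : 0 < e) (finj : injective_at_scale e f).

Lemma pressure_lt_growth (g : R) : (pressure f phi < g%:E)%E ->
  exists2 C : R, 0 <= C &
    forall k x, (fiber_sum f phi k x <= (C * expR (k%:R * g))%:E)%E.
Proof.
move=> pg; have [B phiB] := compact_bounded_fun cM cphi.
have [[d [d0 de dg]]|nd] := pselect (exists d, [/\ 0 < d, d + d <= e &
    (pressure_scale f phi setT d < g%:E)%E]).
  exact: (fiber_sum_le_pressure phiB cM cf finj d0 de dg).
(* If no scale d <= e / 2 had pressure below [g], the limit over the scales would be at least
   [g]. *)
move: pg; rewrite ltNge => /negP[]; apply: lime_ge.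
  exact: pressure_scale_is_cvg.
near=> d; rewrite leNgt; apply/negP => dg; apply: nd; exists d; split => //.
have : d <= e / 2 by near: d; apply: nbhs_right_le; rewrite divr_gt0.
lra.
Unshelve. all: by end_near. Qed.

Lemma ereal_lt_dense (p : \bar R) (th : R) : (p < th%:E)%E ->
  exists2 g : R, g < th & (p < g%:E)%E.
Proof.
case: p => [p| |]; rewrite ?lte_fin.
- by move=> pt; exists ((p + th) / 2); rewrite ?lte_fin; lra.
- by rewrite ltNge leey.
- by move=> _; exists (th - 1); [lra|exact: ltNyr].
Qed.

(** Iterating the bound gives exp(k n th) <= A_(kn), which contradicts the bound C exp(k n g)
    available for some g < th if the pressure is below [th]. *)
Lemma growth_le_pressure (th : R) n (x : M) : (0 < n)%N ->
  (forall y, ((expR (n%:R * th))%:E <= fiber_sum f phi n y)%E) ->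
  (th%:E <= pressure f phi)%E.
Proof.
move=> n0 hn; rewrite leNgt; apply/negP => /ereal_lt_dense[g gth /pressure_lt_growth[C C0 hC]].
suff : n%:R * th <= n%:R * g by rewrite ler_pM2l ?ltr0n// leNgt gth.
apply: (@expR_growth_le _ 1 C) => // k.
have := hC (k * n)%N x; rewrite natrM -mulrA mul1r => h; rewrite -lee_fin.
apply: le_trans h; elim: k => [|k IHk].
  by rewrite mul0n mul0r expR0 fiber_sum0.
rewrite mulSn; apply: le_trans (fiber_sumD_ge _ _ (expR_gt0 _) hn).
by rewrite -natr1 mulrDl mul1r expRD mulrC EFinM lee_wpmul2l// lee_fin expR_ge0.
Qed.

Lemma pressure_lt_growth_eventually (th : R) : (pressure f phi < th%:E)%E ->
  exists2 n, (0 < n)%N &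
    forall x, (fiber_sum f phi n x <= (expR (n%:R * th))%:E)%E.
Proof.
move=> /ereal_lt_dense[g gth /pressure_lt_growth[C C0 hC]].
(* For this n, C <= n (th - g) <= exp(n (th - g)): the gap between [g] and [th] absorbs the
   constant. *)
exists (Num.truncn (C / (th - g))).+1 => // x.
apply: le_trans (hC _ x) _; rewrite lee_fin -ler_pdivlMr ?expR_gt0//.
rewrite -expRN -expRD -mulrBr (le_trans _ (expR_ge1Dx _))// ler_wpDl//.
by rewrite -ler_pdivrMr ?subr_gt0// ltW// truncnS_gt.
Qed.

Lemma relative_pressure_le_growth (S : set M) (th C : R) :
  uniformly_open f -> dense_preimages f -> backward_shadowed f S -> 0 <= C ->
  (forall n, exists x, (fiber_sum f phi n x <= (C * expR (n%:R * th))%:E)%E) ->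
  (relative_pressure f phi S <= th%:E)%E.
Proof.
move=> fop fd sh C0 hC; have [B phiB] := compact_bounded_fun cM cphi.
apply/lee_addgt0Pr => w w0; apply: lime_le.
  exact: pressure_scale_is_cvg.
have [d1 d10 hd1] := compact_uniform_modulus cM cphi w0.
near=> d; rewrite -EFinD.
have d0 : 0 < d by near: d; exact: nbhs_right_gt.
have dd1 : d < d1 by near: d; exact: nbhs_right_lt.
have [d' d'0 hd'] := sh d d0.
have [m hm] := dense_preimages_uniform cM fop fd d'0.
apply: (pressure_scale_le phiB d0 _ _ _ hd' hm C0 hC).
- by move=> y z yz; apply: hd1; exact: lt_trans dd1.
- by move=> n x; apply: countable_fiber finj.
- exact: dense_preimages_surj.
Unshelve. all: by end_near. Qed.

Lemma relative_pressure_le_step_growth (S : set M) (th : R) n (x : M) :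
  uniformly_open f -> dense_preimages f -> backward_shadowed f S -> (0 < n)%N ->
  (forall y, (fiber_sum f phi n y <= (expR (n%:R * th))%:E)%E) ->
  (relative_pressure f phi S <= th%:E)%E.
Proof.
move=> fop fd sh n0 hn; have [B phiB] := compact_bounded_fun cM cphi.
have [D D0 hD] := fiber_sum_growth cM e0 finj phiB.
(* Orders are divided by [n] with remainder; [C] pays for every possible remainder through the crude
   bound [D ^+ r]. *)
pose C := \sum_(r < n) D ^+ r * expR (- (r%:R * th)).
have D_ge0 k : 0 <= D ^+ k * expR (- (k%:R * th)).
  by rewrite mulr_ge0 ?expR_ge0// exprn_ge0 ?ltW.
apply: (@relative_pressure_le_growth _ _ C) => //; first exact: sumr_ge0.
move=> k; exists x; rewrite (divn_eq k n).
elim: (k %/ n)%N => [|q IHq].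
  rewrite mul0n add0n (le_trans (hD _ _))// lee_fin -ler_pdivrMr ?expR_gt0//.
  rewrite -expRN /C (bigD1 (Ordinal (ltn_pmod k n0)))//= lerDl.
  exact: sumr_ge0.
rewrite mulSn -addnA; apply: le_trans (fiber_sumD_le _ _ (expR_gt0 _) hn) _.
apply: le_trans (lee_wpmul2l _ IHq) _; first by rewrite lee_fin expR_ge0.
by rewrite -EFinM lee_fin mulrCA -expRD -mulrDl -natrD.
Qed.

End GrowthPressure.

(** * Fibres of nearby maps *)

Section NearbyFibers.
Context {R : realType} {M : metricType R} {I : Type} (F : set_system I).
Context {FF : Filter F}.
Variables (h k : I -> M -> M).
Hypothesis h_open : forall e : R, 0 < e -> exists2 d, 0 < d & \forall i \near F,
  forall x z, mdist (h i x) z < d -> exists2 y, mdist x y < e & h i y = z.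
Hypothesis h_close : forall s : R, 0 < s ->
  \forall i \near F, forall x, mdist (h i x) (k i x) < s.

(** Orbits of [k i] are shadowed by lifting backwards through [h i]: the target [x] is pulled back
    one step to [w], near the n-th point of the orbit of [y], and the induction hypothesis is
    applied to [w]. *)
Lemma near_fiber_shadow n (e : R) : 0 < e -> exists2 d, 0 < d & \forall i \near F,
  forall y x, mdist (iter n (k i) y) x < d -> exists2 z, iter n (h i) z = x &
    forall j, (j <= n)%N -> mdist (iter j (h i) z) (iter j (k i) y) < e.
Proof.
move=> e0; elim: n => [|n [dn dn0 IHn]].
  exists e => //; near=> i => y x /= yx; exists x => // j.
  by rewrite leqn0 => /eqP -> /=; rewrite metric_sym.
have [d d0 hd] := h_open dn0.
(* The other [d / 2] is for the displacement between [h i] and [k i]; the bound by [e] settles the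
   last time, n + 1. *)
exists (Num.min (d / 2) e); first by rewrite lt_min divr_gt0.
near=> i => y x /=; rewrite lt_min => /andP[yx1 yx2].
have hk : forall x, mdist (h i x) (k i x) < d / 2.
  by near: i; apply: h_close; rewrite divr_gt0.
have IHi : forall y x, mdist (iter n (k i) y) x < dn -> exists2 z, iter n (h i) z = x &
    forall j, (j <= n)%N -> mdist (iter j (h i) z) (iter j (k i) y) < e.
  by near: i.
have [w yw wx] : exists2 w, mdist (iter n (k i) y) w < dn & h i w = x.
  have hi : forall x z, mdist (h i x) z < d ->
    exists2 y, mdist x y < dn & h i y = z by near: i.
  apply: hi; rewrite (le_lt_trans (metric_triangle _ (k i (iter n (k i) y)) _))//.
  by rewrite (splitr d) ltrD.
have [z zw hz] := IHi _ _ yw.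
exists z => [|j]; first by rewrite zw.
rewrite leq_eqVlt => /predU1P[->|]; last exact: hz.
by rewrite /= zw wx metric_sym.
Unshelve. all: by end_near. Qed.

(** The two families play different roles: openness of [h] supplies a partner in the fibre of [h i]
    for each point of the fibre of [k i], and injectivity of [k] at scale [e0] prevents two points
    from sharing a partner. *)
Lemma near_fiber_sum_le (phih phik : I -> M -> R) n (e0 w : R) : 0 < e0 ->
  (\forall i \near F, injective_at_scale e0 (k i)) ->
  (exists2 e, 0 < e & \forall i \near F, forall x y, mdist x y < e ->
     `|phik i x - phih i y| <= w) ->
  \forall i \near F, forall x, (fiber_sum (k i) (phik i) n x <=
    (expR (n%:R * w))%:E * fiber_sum (h i) (phih i) n x)%E.
Proof.
move=> e00 kinj [e1 e10 he1].
have m0 : 0 < Num.min e1 (e0 / 2) by rewrite lt_min e10 divr_gt0.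
have [d d0 hd] := near_fiber_shadow n m0.
near=> i => x.
have finj : injective_at_scale e0 (k i) by near: i.
have pclose : forall x y, mdist x y < e1 -> `|phik i x - phih i y| <= w by near: i.
have sh : forall y x, mdist (iter n (k i) y) x < d -> exists2 z, iter n (h i) z = x &
    forall j, (j <= n)%N -> mdist (iter j (h i) z) (iter j (k i) y) < Num.min e1 (e0 / 2).
  by near: i.
rewrite /fiber_sum -esumZ ?expR_gt0//.
apply: (esum_le_rel (r := fun y z => forall j, (j <= n)%N ->
    mdist (iter j (h i) z) (iter j (k i) y) < Num.min e1 (e0 / 2))).
- by move=> z _; rewrite -EFinM lee_fin mulr_ge0 ?expR_ge0.
- move=> y /= yx; have [|z zx hz] := sh y x; first by rewrite yx mdistxx.
  exists z; split=> //; rewrite -EFinM lee_fin -expRD ler_expR -lerBlDr.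
  have := @birkhoff_sum_close _ _ (k i) (h i) (phik i) (phih i) w n y z.
  move=> hb; apply: le_trans (ler_norm _) _; apply: hb => j jn.
  apply: pclose; rewrite metric_sym.
  by apply: lt_le_trans (hz j (ltnW jn)) _; rewrite ge_min lexx.
- move=> y y' z /= yx y'x hy hy'; apply: (injective_at_scale_iter finj (n := n)).
    move=> j jn; have := hy j (ltnW jn); have := hy' j (ltnW jn).
    rewrite !lt_min => /andP[_ h1] /andP[_ h2].
    rewrite (le_lt_trans (metric_triangle _ (iter j (h i) z) _))//.
    by rewrite (splitr e0) ltrD// metric_sym.
  by rewrite yx.
Unshelve. all: by end_near. Qed.

End NearbyFibers.

(** * A quantitative inverse function theorem *)

Section MatrixNorm.
Context {R : realType}.

Lemma mx_entry_le_norm m n (A : 'M[R]_(m, n)) i j : `|A i j| <= `|A|.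
Proof. by rewrite [leRHS]/Num.Def.normr/= mx_normrE (le_bigmax _ (fun ij => `|A ij.1 ij.2|) (i, j)). Qed.

Lemma mx_norm_le m n (A : 'M[R]_(m, n)) (b : R) : 0 <= b ->
  (forall i j, `|A i j| <= b) -> `|A| <= b.
Proof.
by move=> b0 h; rewrite [leLHS]/Num.Def.normr/= mx_normrE bigmax_le// => -[i j] _; exact: h.
Qed.

(** The matrix norm is the largest absolute value of an entry; this is where the dimension factors
    in the later constants come from. *)
Lemma norm_mulmx_le m n p (u : 'M[R]_(p, m)) (A : 'M[R]_(m, n)) :
  `|u *m A| <= m%:R * (`|u| * `|A|).
Proof.
apply: mx_norm_le => [|i j]; first by rewrite !mulr_ge0.
rewrite mxE (le_trans (ler_norm_sum _ _ _))//.
rewrite mulrC mulr_natr -[X in _ *+ X]card_ord -sumr_const.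
by apply: ler_sum => k _; rewrite normrM ler_pM// mx_entry_le_norm.
Qed.

Lemma norm_mulmx_le_r n (A : 'M[R]_n) (v : 'rV[R]_n) : A \in unitmx ->
  `|v| <= n%:R * `|invmx A| * `|v *m A|.
Proof.
move=> uA; rewrite -{1}(mulmxK uA v) (le_trans (norm_mulmx_le _ _))//.
by rewrite [`|v *m A| * _]mulrC mulrA.
Qed.

End MatrixNorm.

Section Quantitative.
Context {R : realType} {m n : nat}.

Lemma is_derive_line (F : 'rV[R]_m -> 'rV[R]_n) (y v : 'rV[R]_m) (t : R) j :
  differentiable F (y + t *: v) ->
  is_derive t 1 (fun s => F (y + s *: v) 0 j) ((v *m 'J F (y + t *: v)) 0 j).
Proof.
move=> dF; pose G s := F (y + s *: v).
have gE : (fun h : R => h^-1 *: (G (h *: 1 + t) - G t)) =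
    (fun h : R => h^-1 *: (F (h *: v + (y + t *: v)) - F (y + t *: v))).
  apply/funext => h; rewrite /G; congr (_ *: (F _ - _)).
  by rewrite [h *: 1]mulr1 scalerDl addrCA.
have dG : derivable G t 1.
  have := diff_derivable (v := v) dF.
  by rewrite /derivable gE.
have DG : 'D_1 G t = v *m 'J F (y + t *: v).
  by rewrite -deriveEjacobian// /derive gE.
split; first by move/derivable_mxP: dG; apply.
by rewrite -DG derive_mx// mxE.
Qed.

Lemma jacobian_lipschitz (F : 'rV[R]_m -> 'rV[R]_n) (A : 'M[R]_(m, n))
    (p : 'rV[R]_m) (s k : R) :
  (forall u, `|u - p| <= s -> differentiable F u /\ `|'J F u - A| <= k) ->
  forall x y, `|x - p| <= s -> `|y - p| <= s ->
  `|F x - F y - (x - y) *m A| <= m%:R * k * `|x - y|.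
Proof.
move=> h x y xs ys; have s0 : 0 <= s by exact: le_trans xs.
have k0 : 0 <= k.
  by have [] := h p; rewrite ?subrr ?normr0// => _; exact: le_trans.
pose v := x - y.
have seg t : 0 <= t <= 1 -> `|y + t *: v - p| <= s.
  move=> /andP[t0 t1].
  (* The segment stays in the ball by convexity, so the mean value theorem applies to each
     coordinate along it. *)
  have -> : y + t *: v - p = (1 - t) *: (y - p) + t *: (x - p).
    rewrite /v !scalerBr !scalerBl !scale1r.
    rewrite !opprB !addrA; apply/rowP => i; rewrite !mxE; ring.
  rewrite (le_trans (ler_normD _ _))// !normrZ !ger0_norm ?subr_ge0//.
  rewrite -[s](_ : (1 - t) * s + t * s = s); last by ring.
  by rewrite lerD// ler_wpM2l// subr_ge0.
apply: mx_norm_le => [|i j]; first by rewrite !mulr_ge0.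
rewrite (ord1 i){i}.
have [||c /= c01] := @MVT_segment R (fun t => F (y + t *: v) 0 j)
    (fun t => (v *m 'J F (y + t *: v)) 0 j) 0 1 ler01.
- move=> t t01; apply: is_derive_line; apply: (proj1 (h _ (seg t _))).
  by move: t01; rewrite in_itv/= => /andP[/ltW -> /ltW ->].
- apply: continuous_in_subspaceT => t; rewrite inE/= in_itv/= => t01.
  have [] := @is_derive_line F y v t j (proj1 (h _ (seg t t01))).
  by move=> /derivable1_diffP /differentiable_continuous.
rewrite subr0 mulr1 scale1r scale0r addr0 /v subrKC => E.
rewrite !mxE in E *; rewrite E -/v.
rewrite -[X in `|X|](_ : (v *m ('J F (y + c *: v) - A)) 0 j = _); last first.
  by rewrite mulmxBr !mxE.
have [_ hc] := h _ (seg c c01).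
rewrite (le_trans (mx_entry_le_norm _ _ _))// (le_trans (norm_mulmx_le _ _))//.
by rewrite -mulrA ler_wpM2l// mulrC ler_wpM2r.
Qed.

End Quantitative.

HB.instance Definition _ (R : realType) (m n : nat) :=
  Uniform_isComplete.Build 'M[R]_(m, n) cauchy_cvg.

Section InverseFunction.
Context {R : realType} {n : nat}.
Variables (F : 'rV[R]_n -> 'rV[R]_n) (A : 'M[R]_n) (p : 'rV[R]_n) (s k : R).
Hypothesis FA : forall u, `|u - p| <= s -> differentiable F u /\ `|'J F u - A| <= k.
Hypothesis uA : A \in unitmx.
Hypothesis k_small : n%:R * `|invmx A| * (n%:R * k) <= 1 / 2.

Let L := n%:R * `|invmx A|.
Let L0 : 0 <= L. Proof. by rewrite mulr_ge0. Qed.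

Let newton_dist x y : `|x - p| <= s -> `|y - p| <= s ->
  `|(x - y) - (F x - F y) *m invmx A| <= 1 / 2 * `|x - y|.
Proof.
move=> xs ys; rewrite -{1}(mulmxK uA (x - y)) -mulmxBl.
rewrite (le_trans (norm_mulmx_le _ _))// [`|_ - _| * _]mulrC mulrA -/L.
rewrite distrC (le_trans (ler_wpM2l L0 (jacobian_lipschitz FA xs ys)))//.
by rewrite mulrA ler_wpM2r.
Qed.

Lemma jacobian_injective x y : `|x - p| <= s -> `|y - p| <= s ->
  F x = F y -> x = y.
Proof.
move=> xs ys Fxy; have := newton_dist xs ys; rewrite Fxy subrr mul0mx subr0.
move=> h; apply/eqP; rewrite -subr_eq0 -normr_le0; lra.
Qed.

(** A solution is a fixed point of the Newton map with derivative frozen at [A]. By [k_small] the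
    map contracts by 1/2, and it moves [x] by at most r / 2, so it preserves the ball of radius [r]
    about [x]. The centre [x] may differ from [p], which makes the estimate uniform near [p]. *)
Lemma jacobian_surjective x z r : 0 <= r -> r <= s / 2 -> `|x - p| <= s / 2 ->
  L * `|z - F x| <= r / 2 -> exists2 y, `|y - x| <= r & F y = z.
Proof.
move=> r0 rs xs zr; pose U := closed_ball_ Num.norm x r.
pose T (u : 'rV[R]_n) := u + (z - F u) *m invmx A.
have Us u : U u -> `|u - p| <= s.
  rewrite /U /closed_ball_/= => ux; rewrite -(subrKA x).
  rewrite (le_trans (ler_normD _ _))// [leRHS](splitr s) lerD//.
  by rewrite distrC (le_trans ux).
have Tdist u w : U u -> U w -> `|T u - T w| <= 1 / 2 * `|u - w|.
  move=> /Us us /Us ws; rewrite /T.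
  rewrite [X in `|X|](_ : _ = (u - w) - (F u - F w) *m invmx A).
    exact: newton_dist.
  by rewrite !mulmxBl; apply/rowP => i; rewrite !mxE; ring.
have Ux : U x by rewrite /U /closed_ball_/= subrr normr0.
have TU : set_fun U U T.
  move=> u Uu; have := Tdist u x Uu Ux.
  have : `|T x - x| <= r / 2.
    rewrite /T addrC addKr (le_trans (norm_mulmx_le _ _))//.
    by rewrite [`|_ - _| * _]mulrC mulrA.
  have := Uu; rewrite /U /closed_ball_/= [`|x - u|]distrC => ux h1 h2.
  rewrite distrC -(subrKA (T x)) (le_trans (ler_normD _ _))//; lra.
have ctr : is_contraction (mkfun TU).
  exists (1 / 2)%:nng; split; first by rewrite /=; lra.
  by move=> [u w] /= [Uu Uw]; exact: Tdist.
have [||y Uy yE] := banach_fixed_point ctr; first exact: closed_closed_ball_.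
  by exists x.
exists y; first by rewrite distrC.
have : (z - F y) *m invmx A = 0.
  by apply: (addrI y); rewrite addr0 [RHS]yE.
move/(congr1 (mulmx^~ A)); rewrite mulmxKV// mul0mx => /eqP.
by rewrite subr_eq0 => /eqP.
Qed.

End InverseFunction.

(** * Gram norms *)

Section GramNorm.
Context {R : realType} {n : nat}.
Implicit Types (G : 'M[R]_n) (u v : 'rV[R]_n).

Definition gram_norm G v : R := Num.sqrt ((v *m G *m v^T) 0 0).

Definition positive_definite G :=
  G^T = G /\ forall v, v != 0 -> 0 < (v *m G *m v^T) 0 0.

Lemma gram_normE G v : gram_norm G v =
  Num.sqrt (\sum_j (\sum_i v 0 i * G i j) * v 0 j).
Proof.
by rewrite /gram_norm mxE; congr Num.sqrt; apply: eq_bigr => j _; rewrite !mxE.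
Qed.

Lemma gram_norm_ge0 G v : 0 <= gram_norm G v.
Proof. exact: sqrtr_ge0. Qed.

Lemma gram_normZ G a v : gram_norm G (a *: v) = `|a| * gram_norm G v.
Proof.
rewrite /gram_norm -scalemxAl linearZ/= -scalemxAl -scalemxAr !mxE mulrA -expr2.
by rewrite sqrtrM ?sqr_ge0// sqrtr_sqr.
Qed.

Lemma gram_norm_gt0 G v : positive_definite G -> v != 0 -> 0 < gram_norm G v.
Proof. by move=> [_ Gp] v0; rewrite sqrtr_gt0 Gp. Qed.

Lemma gram_norm0 G : gram_norm G 0 = 0.
Proof. by rewrite /gram_norm !mul0mx mxE sqrtr0. Qed.

Lemma gram_normD G u v : positive_definite G ->
  gram_norm G (u + v) <= gram_norm G u + gram_norm G v.
Proof.
move=> Gpd; have [Gs Gp] := Gpd.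
have [->|u0] := eqVneq u 0; first by rewrite gram_norm0 !add0r.
have [->|v0] := eqVneq v 0; first by rewrite gram_norm0 !addr0.
set a := gram_norm G u; set b := gram_norm G v.
have a0 : 0 < a by exact: gram_norm_gt0.
have b0 : 0 < b by exact: gram_norm_gt0.
pose B x y := (x *m G *m y^T : 'M[R]_1) 0 0.
have Bge0 x : 0 <= B x x.
  by have [->|x0] := eqVneq x 0; [rewrite /B !mul0mx mxE|exact/ltW/Gp].
have aE : B u u = a ^+ 2 by rewrite sqr_sqrtr ?Bge0.
have bE : B v v = b ^+ 2 by rewrite sqr_sqrtr ?Bge0.
have BC : B v u = B u v.
  rewrite /B; transitivity ((v *m G *m u^T)^T 0 0); first by rewrite [RHS]mxE.
  by rewrite !trmx_mul trmxK Gs mulmxA.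
have BD x y z : B (x + y) z = B x z + B y z by rewrite /B !mulmxDl mxE.
have BDr x y z : B x (y + z) = B x y + B x z.
  by rewrite /B linearD/= mulmxDr mxE.
have BZ (c : R) x y : B (c *: x) y = c * B x y by rewrite /B -!scalemxAl mxE.
have BZr (c : R) x y : B x (c *: y) = c * B x y.
  by rewrite /B linearZ/= -scalemxAr mxE.
have Buv : B u v <= a * b.
  (* Cauchy-Schwarz: with a and b the norms of u and v, this vector has square norm 2 a b (a b - B u
     v). *)
  have := Bge0 (b *: u + (- a) *: v).
  rewrite !BD !BDr !BZ !BZr BC aE bE => h.
  have ab0 : 0 < a * b by rewrite mulr_gt0.
  rewrite -(ler_pM2l ab0); move: h; lra.
rewrite -(@ler_pXn2r _ 2)// ?nnegrE ?gram_norm_ge0 ?addr_ge0 ?(ltW a0) ?(ltW b0)//.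
rewrite sqr_sqrtr ?Bge0// -/(B _ _) BD !BDr BC aE bE sqrrD.
lra.
Qed.

End GramNorm.

Section GramNormLocal.
Context {R : realType} {n : nat} {T : topologicalType}.

Let sphere : set 'rV[R]_n := [set v | `|v| = 1].

Let compact_sphere : compact sphere.
Proof.
apply: bounded_closed_compact.
  by exists 1; split=> // M M1 v /= ->; exact: ltW.
rewrite (_ : sphere = Num.norm @^-1` [set 1 : R])//.
apply: preimage_closed => [v _|]; first exact: norm_continuous.
exact: closed_eq.
Qed.

Lemma gram_norm_equiv (G : T -> 'M[R]_n) (x : T) :
  (forall i j, {for x, continuous (fun y => G y i j : R)}) ->
  positive_definite (G x) ->
  exists2 c, 0 < c & exists2 C, 0 < C &
    \forall y \near x, forall v, c * `|v| <= gram_norm (G y) v <= C * `|v|.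
Proof.
move=> cG [Gs Gp].
pose Q (y : T) (v : 'rV[R]_n) := \sum_j (\sum_i v 0 i * G y i j) * v 0 j.
have Qpos v : v != 0 -> 0 < Q x v.
  move=> v0; have := @gram_norm_gt0 _ _ (G x) v (conj Gs Gp) v0.
  by rewrite gram_normE sqrtr_gt0.
have cQ v : (fun p : T * 'rV[R]_n => Q p.1 p.2) @ nbhs (x, v) --> Q x v.
  have c2 i : (fun p : T * 'rV[R]_n => p.2 0 i) @ nbhs (x, v) --> v 0 i.
    apply: (@cvg_comp _ _ _ snd (fun w : 'rV[R]_n => w 0 i) _ (nbhs v)).
      exact: cvg_snd.
    exact: coord_continuous.
  have c1 i j : (fun p : T * 'rV[R]_n => G p.1 i j) @ nbhs (x, v) --> G x i j.
    apply: (@cvg_comp _ _ _ fst (fun y : T => G y i j) _ (nbhs x)).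
      exact: cvg_fst.
    exact: cG.
  apply: cvg_big => [|j _]; first exact: add_continuous.
  apply: cvgM => //; apply: cvg_big => [|i _]; first exact: add_continuous.
  by apply: cvgM.
(* A single large parameter t bounds the quadratic form from both sides, between 1/t and t, so that
   compactness of the unit sphere is used once. *)
have : \forall p \near filter_prod (nbhs x) (@pinfty_nbhs R),
    sphere `<=` (fun v => p.2^-1 < Q p.1 v /\ Q p.1 v < p.2).
  apply: (iffLR (compact_near_coveringP sphere) compact_sphere _ _
    (fun p v => p.2^-1 < Q p.1 v /\ Q p.1 v < p.2)) => v /= v1.
  have v0 : v != 0 by rewrite -normr_gt0 v1.
  have q0 := Qpos v v0; set q := Q x v in q0.
  have [[V W] /= [xV vW] VW] : nbhs (x, v) [set p | q / 2 < Q p.1 p.2 < q * 2].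
    have qI : nbhs q [set r | q / 2 < r < q * 2].
      by apply: near_in_itvoo; rewrite in_itv/=; apply/andP; split; lra.
    exact: (cQ v _ qI).
  exists (W, V `*` [set t | Num.max (q * 2) (2 / q) < t]); first split => //=.
    exists (V, [set t | Num.max (q * 2) (2 / q) < t]) => //=; split => //.
    by apply: nbhs_pinfty_gt; exact: num_real.
  move=> [w [y t]] [/= Ww [Vy]]; rewrite gt_max => /andP[qt1 qt2].
  have /andP[h1 h2] := VW (y, w) (conj Vy Ww).
  split; last exact: lt_trans qt1.
  apply: le_lt_trans h1; rewrite -invf_div lef_pV2 ?posrE ?divr_gt0//.
    exact: ltW.
  by apply: lt_trans qt2; rewrite divr_gt0.
case=> -[V W] /= [xV WW] VW.
have [t [t0 Wt]] : exists t : R, 0 < t /\ W t.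
  have [t [Wt t0]] : exists t : R, W t /\ 0 < t.
    have : \forall t \near +oo_R, W t /\ 0 < t.
      by apply: filterI => //; apply: nbhs_pinfty_gt; exact: num_real.
    by move=> /filter_ex.
  by exists t.
exists (Num.sqrt t^-1); first by rewrite sqrtr_gt0 invr_gt0.
exists (Num.sqrt t); first by rewrite sqrtr_gt0.
apply: filterS xV => y Vy v.
have [->|v0] := eqVneq v 0; first by rewrite gram_norm0 normr0 !mulr0 lexx.
have nv0 : 0 < `|v| by rewrite normr_gt0.
have [h1 h2] := VW (y, t) (conj Vy Wt) (`|v|^-1 *: v)
  (ltac:(by rewrite /sphere/= normrZ normfV normr_id mulVf ?gt_eqF)).
have -> : gram_norm (G y) v = `|v| * gram_norm (G y) (`|v|^-1 *: v).
  by rewrite gram_normZ normfV normr_id mulrA mulfV ?gt_eqF// mul1r.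
rewrite ![_ * `|v|]mulrC !ler_pM2l// gram_normE !ler_wsqrtr//.
- exact: ltW.
- exact: ltW.
Qed.

End GramNormLocal.

(** * Local diffeomorphisms in charts *)

Section Jacobians.
Context {R : realType}.

Lemma mulmx_inj_row m n (A B : 'M[R]_(m, n)) :
  (forall v : 'rV[R]_m, v *m A = v *m B) -> A = B.
Proof. by move=> h; apply/row_matrixP => i; rewrite !rowE. Qed.

Lemma jacobian_comp m n p (f : 'rV[R]_m -> 'rV[R]_n) (g : 'rV[R]_n -> 'rV[R]_p) x :
  differentiable f x -> differentiable g (f x) ->
  'J (g \o f) x = 'J f x *m 'J g (f x).
Proof.
move=> df dg; apply: mulmx_inj_row => v; rewrite mulmxA.
by rewrite /jacobian !mul_rV_lin1/= diff_comp.
Qed.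

Lemma jacobian_near_eq m n (f g : 'rV[R]_m -> 'rV[R]_n) x :
  differentiable f x -> differentiable g x ->
  (\forall y \near x, f y = g y) -> 'J f x = 'J g x.
Proof.
move=> df dg fg; apply: mulmx_inj_row => v.
transitivity ('D_v f x); first exact/esym/deriveEjacobian.
transitivity ('D_v g x); last exact: deriveEjacobian.
exact: near_eq_derive.
Qed.

Lemma jacobian_id m (x : 'rV[R]_m) : 'J id x = 1%:M.
Proof.
apply: mulmx_inj_row => v; rewrite /jacobian mul_rV_lin1/= mulmx1.
by rewrite diff_val.
Qed.

Lemma jacobian_comp_near_eq m n n' p (f : 'rV[R]_m -> 'rV[R]_n)
    (g : 'rV[R]_n -> 'rV[R]_p) (f' : 'rV[R]_m -> 'rV[R]_n')
    (g' : 'rV[R]_n' -> 'rV[R]_p) x :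
  differentiable f x -> differentiable g (f x) ->
  differentiable f' x -> differentiable g' (f' x) ->
  (\forall u \near x, g (f u) = g' (f' u)) ->
  'J f x *m 'J g (f x) = 'J f' x *m 'J g' (f' x).
Proof.
move=> df dg df' dg' e.
transitivity ('J (g \o f) x); first exact/esym/jacobian_comp.
transitivity ('J (g' \o f') x); last exact: jacobian_comp.
by apply: jacobian_near_eq e; exact: differentiable_comp.
Qed.

Lemma jacobian_left_inverse m (f g : 'rV[R]_m -> 'rV[R]_m) x :
  differentiable f x -> differentiable g (f x) ->
  (\forall u \near x, g (f u) = u) -> 'J f x \in unitmx.
Proof.
move=> df dg e.
suff E : 'J f x *m 'J g (f x) = 1%:M by exact: (proj1 (mulmx1_unit E)).
transitivity ('J id x *m 'J id (id x)).
  by apply: (jacobian_comp_near_eq df dg) e; exact: ex_diff.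
by rewrite !jacobian_id mul1mx.
Qed.

End Jacobians.

Section Charts.
Context {R : realType} {M : metricType R} {n : nat} (X : riemannian_structure M n).
Implicit Types (f g : M -> M) (i j : chart X) (x : M).

Definition chart_rep f i j : 'rV[R]_n -> 'rV[R]_n := crd X j \o f \o par X i.

Definition chart_gram i x : 'M[R]_n := gram X i (crd X i x).

Lemma near_chart i x (P : M -> Prop) : dom X i x -> (\forall y \near x, P y) ->
  \forall u \near crd X i x,
    [/\ dom X i (par X i u), crd X i (par X i u) = u & P (par X i u)].
Proof.
move=> ix Px.
have cp : par X i @ nbhs (crd X i x) --> x.
  by rewrite -{2}(crdK ix); apply: par_continuous; exists x.
have H1 : \forall u \near crd X i x, P (par X i u) by exact: cp.
have H2 : \forall u \near crd X i x, (crd X i @` dom X i) u.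
  by apply: open_nbhs_nbhs; split; [exact: open_crd|exists x].
near=> u; have : (crd X i @` dom X i) u by near: u.
move=> [y iy yu]; rewrite -yu crdK//; split=> //.
by rewrite -(crdK iy) yu; near: u.
Unshelve. all: by end_near. Qed.

Lemma local_diffeo_continuous f : C1_local_diffeo X f -> continuous f.
Proof. by move=> hf x; have [U [g [[_ Ux _] [_ [cf _] _]]]] := hf x; exact: cf. Qed.

Lemma near_chart_image (U : set M) f i j x : open U -> U x -> {for x, continuous f} ->
  dom X i x -> dom X j (f x) ->
  \forall u \near crd X i x,
    (crd X i @` (U `&` dom X i `&` f @^-1` dom X j)) u.
Proof.
move=> oU Ux cf ix jfx.
have Px : \forall y \near x, U y /\ dom X j (f y).
  apply: filterI; first exact: open_nbhs_nbhs.
  by apply: cf; apply: open_nbhs_nbhs; split=> //; exact: open_dom.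
near=> u; have [du cu [Uu ju]] : [/\ dom X i (par X i u), crd X i (par X i u) = u &
    U (par X i u) /\ dom X j (f (par X i u))].
  by near: u; exact: (near_chart ix Px).
by exists (par X i u).
Unshelve. all: by end_near. Qed.

Lemma chart_rep_differentiable f i j x : C1_local_diffeo X f ->
  dom X i x -> dom X j (f x) ->
  differentiable (chart_rep f i j) (crd X i x) /\
  forall v, {for crd X i x, continuous (fun p => 'd (chart_rep f i j) p v)}.
Proof.
move=> hf ix jfx; have [U [g [[oU Ux _] [_ [cf C1f] _]]]] := hf x.
have xU : (crd X i @` (U `&` dom X i `&` f @^-1` dom X j)) (crd X i x) by exists x.
have [df cdf] := C1f i j.
by split=> [|v]; [exact: df|exact: cdf].
Qed.

Lemma transition_differentiable i j x : dom X i x -> dom X j x ->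
  differentiable (crd X j \o par X i) (crd X i x).
Proof.
by move=> ix jx; have [d _] := transition_smooth i j 1; apply: d; exists x.
Qed.

Lemma jacobian_chart_rep_unit f i j x : C1_local_diffeo X f ->
  dom X i x -> dom X j (f x) ->
  'J (chart_rep f i j) (crd X i x) \in unitmx.
Proof.
move=> hf ix jfx; have [U [g [[oU Ux ofU] [gf [cf C1f] [cg C1g]]]]] := hf x.
have [df _] := chart_rep_differentiable hf ix jfx.
have gfx := gf _ Ux.
have dg : differentiable (chart_rep g j i) (crd X j (f x)).
  have [dg _] := C1g j i; apply: dg; exists (f x) => //; split; last by rewrite /= gfx.
  by split => //; exists x.
have fE : chart_rep f i j (crd X i x) = crd X j (f x) by rewrite /chart_rep/= crdK.
apply: (jacobian_left_inverse df); first by rewrite fE; exact: dg.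
have := near_chart_image oU Ux (cf _ Ux) ix jfx.
apply: filterS => u [y [[Uy iy] jfy] <-].
by rewrite /chart_rep/= crdK// crdK// gf.
Qed.

Lemma positive_definite_chart_gram i x : dom X i x ->
  positive_definite (chart_gram i x).
Proof.
by move=> ix; split; [exact: gram_sym|move=> v v0; exact: gram_pos].
Qed.

Lemma gram_norm_transition i j x v : dom X i x -> dom X j x ->
  gram_norm (chart_gram i x) v =
  gram_norm (chart_gram j x) (v *m 'J (crd X j \o par X i) (crd X i x)).
Proof.
move=> ix jx; rewrite /gram_norm /chart_gram (gram_tensor ix jx)/=.
by rewrite trmx_mul !mulmxA.
Qed.

Lemma chart_gram_continuous i x : dom X i x ->
  forall a b, {for x, continuous (fun y => chart_gram i y a b)}.
Proof.
move=> ix a b; apply: (@continuous_comp _ _ _ (crd X i) (fun p => gram X i p a b)).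
  exact: crd_continuous.
by have := gram_smooth i a b 0; apply; exists x.
Qed.

Lemma chart_gram_equiv i x : dom X i x ->
  exists2 c, 0 < c & exists2 C, 0 < C &
    \forall y \near x, forall v, c * `|v| <= gram_norm (chart_gram i y) v <= C * `|v|.
Proof.
move=> ix; apply: gram_norm_equiv; first exact: chart_gram_continuous.
exact: positive_definite_chart_gram.
Qed.

Lemma jacobian_chart_change f i i' j j' x : C1_local_diffeo X f ->
  dom X i x -> dom X i' x -> dom X j (f x) -> dom X j' (f x) ->
  'J (crd X i' \o par X i) (crd X i x) *m 'J (chart_rep f i' j') (crd X i' x) =
  'J (chart_rep f i j) (crd X i x) *m 'J (crd X j' \o par X j) (crd X j (f x)).
Proof.
move=> hf ix i'x jfx j'fx.
have E1 : (crd X i' \o par X i) (crd X i x) = crd X i' x by rewrite /= crdK.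
have E2 : chart_rep f i j (crd X i x) = crd X j (f x) by rewrite /chart_rep/= crdK.
have d1 := transition_differentiable ix i'x.
have d2 := transition_differentiable jfx j'fx.
have [df _] := chart_rep_differentiable hf ix jfx.
have [df' _] := chart_rep_differentiable hf i'x j'fx.
have df1 : differentiable (chart_rep f i' j') ((crd X i' \o par X i) (crd X i x)).
  by rewrite E1.
have d21 : differentiable (crd X j' \o par X j) (chart_rep f i j (crd X i x)).
  by rewrite E2.
rewrite -{1}E1 -{1}E2; apply: (jacobian_comp_near_eq d1 df1 df d21).
have Px : \forall y \near x, dom X i' y /\ dom X j (f y).
  apply: filterI; first by apply: open_nbhs_nbhs; split=> //; exact: open_dom.
  apply: (local_diffeo_continuous hf).
  by apply: open_nbhs_nbhs; split=> //; exact: open_dom.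
have := near_chart ix Px; apply: filterS => u [_ _ [i'u jfu]].
by rewrite /chart_rep/= !crdK.
Qed.

Lemma tangent_normE x v :
  tangent_norm X x v = gram_norm (chart_gram (chart_at X x) x) v.
Proof. by []. Qed.

Lemma inv_differential_norm_ub f x v : C1_local_diffeo X f ->
  tangent_norm X x v <=
    inv_differential_norm X f x * tangent_norm X (f x) (v *m differential X f x).
Proof.
move=> hf; rewrite !tangent_normE.
have dx := dom_chart_at X x; have dfx := dom_chart_at X (f x).
have uD : differential X f x \in unitmx by exact: jacobian_chart_rep_unit.
have [c c0 [C C0 /nbhs_singleton Cx]] := chart_gram_equiv dx.
have [c' c'0 [C' C'0 /nbhs_singleton C'x]] := chart_gram_equiv dfx.
set S := [set tangent_norm X x (w *m invmx (differential X f x)) |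
  w in [set w | tangent_norm X (f x) w <= 1]].
(* The real [sup] bounds [S] from above only if [S] is bounded; equivalence of the norms provides
   this. *)
have ubS : has_ubound S.
  exists (C * (n%:R * (c'^-1 * `|invmx (differential X f x)|))) => _ [w /= w1 <-].
  rewrite tangent_normE (le_trans (proj2 (andP (Cx _))))// ler_pM2l//.
  rewrite (le_trans (norm_mulmx_le _ _))// ler_wpM2l// ler_wpM2r//.
  rewrite -(ler_pM2l c'0) mulfV ?gt_eqF//.
  by rewrite (le_trans (proj1 (andP (C'x _)))).
set w := v *m differential X f x.
have wv : w *m invmx (differential X f x) = v by rewrite /w mulmxK.
have [w0|w0] := eqVneq w 0.
  by rewrite -wv w0 mul0mx !gram_norm0 mulr0.
have Nw : 0 < gram_norm (chart_gram (chart_at X (f x)) (f x)) w.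
  by apply: gram_norm_gt0 => //; exact: positive_definite_chart_gram.
rewrite -ler_pdivrMr//; apply: ub_le_sup => //.
set N := gram_norm _ w in Nw *.
exists (N^-1 *: w) => /=.
  rewrite tangent_normE gram_normZ gtr0_norm ?invr_gt0//.
  by rewrite mulVf ?gt_eqF.
rewrite -scalemxAl wv tangent_normE gram_normZ gtr0_norm ?invr_gt0//.
by rewrite mulrC.
Qed.

(** The sharp constant holds in every pair of charts with no loss, because the tensor rule makes
    Gram norms independent of the chart. *)
Lemma gram_norm_inv_differential f i j x v : C1_local_diffeo X f ->
  dom X i x -> dom X j (f x) ->
  gram_norm (chart_gram i x) v <= inv_differential_norm X f x *
    gram_norm (chart_gram j (f x)) (v *m 'J (chart_rep f i j) (crd X i x)).
Proof.
move=> hf ix jfx; have dx := dom_chart_at X x; have dfx := dom_chart_at X (f x).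
rewrite (gram_norm_transition _ ix dx) (gram_norm_transition _ jfx dfx).
rewrite -mulmxA -(jacobian_chart_change hf ix dx jfx dfx) mulmxA.
exact: inv_differential_norm_ub.
Qed.

Lemma inv_differential_norm_ge0 f x : 0 <= inv_differential_norm X f x.
Proof.
rewrite /inv_differential_norm; set S := (X in sup X).
have S0 z : S z -> 0 <= z by move=> [w _ <-]; exact: sqrtr_ge0.
have [ubS|nubS] := pselect (has_ubound S); last by rewrite sup_out// => -[].
have S00 : S 0.
  exists 0; first by rewrite /= tangent_normE gram_norm0.
  by rewrite mul0mx tangent_normE gram_norm0.
exact: ub_le_sup.
Qed.

Lemma C1_subbasic_nbhs (f : local_diffeo X) i j (K : set M) (e : R) :
  compact K -> K `<=` dom X i -> f @` K `<=` dom X j -> 0 < e ->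
  nbhs f (C1_subbasic f i j K e).
Proof.
move=> cK Ki fKj e0; rewrite nbhsE/=.
exists (C1_subbasic f i j K e) => //; split.
  exists [set C1_subbasic f i j K e]; last by rewrite bigcup_set1.
  move=> _ ->; exists (finmap.fset1 (C1_subbasic f i j K e)).
    by move=> N; rewrite finmap.inE => /eqP ->; apply: mem_set; exists f, i, j, K, e.
  by rewrite set_fset1 bigcap_set1.
move=> x Kx /=; split; first by apply: fKj; exists x.
- by rewrite subrr normr0.
- by rewrite subrr normr0.
Qed.

End Charts.

(** * Uniform estimates near a local diffeomorphism *)

Section NearbyDiffeos.
Context {R : realType} {M : metricType R} {n : nat} (X : riemannian_structure M n).
Implicit Types (f g : local_diffeo X) (i j : chart X) (x : M).

Lemma jacobian_continuous m (F : 'rV[R]_m -> 'rV[R]_m) p :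
  (forall v, {for p, continuous (fun q => 'd F q v)}) ->
  forall e, 0 < e -> \forall u \near p, `|'J F u - 'J F p| <= e.
Proof.
move=> cF e e0; have H a b : \forall u \near p, `|'J F u a b - 'J F p a b| <= e.
  have c : {for p, continuous (fun q => 'J F q a b : R)}.
    rewrite (_ : (fun q => _) = (fun q => ('d F q (delta_mx 0 a)) 0 b)).
      apply: (@continuous_comp _ _ _ (fun q => 'd F q (delta_mx 0 a))
        (fun w : 'rV[R]_m => w 0 b)); first exact: cF.
      exact: coord_continuous.
    by apply/funext => q; rewrite /jacobian /lin1_mx mxE.
  by move/cvgrPdistC_le: c => /(_ e e0).
have H2 : \forall u \near p, forall a b, `|'J F u a b - 'J F p a b| <= e.
  have H1 a := @filter_forall _ _ (fun b u => `|'J F u a b - 'J F p a b| <= e) _ (nbhs_filter p) (H a).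
  exact: (@filter_forall _ _ (fun a u => forall b, `|'J F u a b - 'J F p a b| <= e) _ (nbhs_filter p) H1).
apply: filterS H2 => u h; apply: mx_norm_le => [|a b]; first exact: ltW.
have -> (A B : 'M[R]_m) : (A - B) a b = A a b - B a b by rewrite !mxE.
exact: h.
Qed.

Lemma ler_dist_halves (V : normedModType R) (a b c : V) (e : R) :
  `|a - b| <= e / 2 -> `|b - c| <= e / 2 -> `|a - c| <= e.
Proof.
move=> ab bc; rewrite -(subrKA b) (le_trans (ler_normD _ _))//.
by rewrite [leRHS]splitr lerD.
Qed.

(** The estimates on nearby maps all draw on the C^1 topology through this lemma. Half of [k] pays
    for the oscillation of [f] on a small closed ball, the other half for the distance from [g] to
    [f] on its compact image under [par X i]. *)
Lemma near_chart_rep f i j x (k : R) : dom X i x -> dom X j (f x) -> 0 < k ->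
  exists2 s, 0 < s & nbhs f [set g : local_diffeo X | forall u, `|u - crd X i x| <= s ->
    [/\ dom X i (par X i u), crd X i (par X i u) = u & dom X j (g (par X i u))] /\
    [/\ differentiable (chart_rep g i j) u,
        `|'J (chart_rep g i j) u - 'J (chart_rep f i j) (crd X i x)| <= k &
        `|chart_rep g i j u - crd X j (f x)| <= k]].
Proof.
move=> ix jfx k0; have k20 : 0 < k / 2 by rewrite divr_gt0.
have hf := local_diffeoP f.
have [df cdf] := chart_rep_differentiable hf ix jfx.
have Pj : \forall y \near x, dom X j (f y).
  by apply: (local_diffeo_continuous hf); apply: open_nbhs_nbhs; split=> //; exact: open_dom.
have H1 := near_chart ix Pj.
have H2 := jacobian_continuous cdf k20.
have H3 : \forall u \near crd X i x, `|chart_rep f i j u - crd X j (f x)| <= k / 2.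
  have /differentiable_continuous /cvgrPdistC_le /(_ _ k20) := df.
  by rewrite [chart_rep f i j (crd X i x)]/chart_rep/= crdK.
pose P u := [/\ dom X i (par X i u), crd X i (par X i u) = u & dom X j (f (par X i u))] /\
    (`|'J (chart_rep f i j) u - 'J (chart_rep f i j) (crd X i x)| <= k / 2 /\
     `|chart_rep f i j u - crd X j (f x)| <= k / 2).
have : nbhs (crd X i x) P by exact: (filterI H1 (filterI H2 H3)).
move=> /nbhs_ballP[e /= e0 he].
pose B := closed_ball_ Num.norm (crd X i x) (e / 2).
have hB u : B u -> P u.
  rewrite /B /closed_ball_/= => ue; apply: he; rewrite -ball_normE/= /ball_/=.
  by rewrite (le_lt_trans ue)// ltr_pdivrMr// ltr_pMr// ltr1n.
pose K := par X i @` B.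
have cK : compact K.
  apply: continuous_compact; last first.
    apply: bounded_closed_compact; last exact: closed_closed_ball_.
    exists (`|crd X i x| + e / 2); split; first exact: num_real.
    move=> r hr u; rewrite /B /closed_ball_/= => ue.
    rewrite (le_trans _ (ltW hr))// -lerBlDl (le_trans _ ue)//.
    by rewrite distrC lerB_dist.
  apply: continuous_in_subspaceT => u /set_mem /hB[[iu cu _] _].
  by apply: par_continuous; exists (par X i u).
exists (e / 2); first by rewrite divr_gt0.
have : nbhs f (C1_subbasic f i j K (k / 2)).
  apply: C1_subbasic_nbhs => //.
    by move=> _ [u /hB[[iu _ _] _] <-].
  by move=> _ [_ [u /hB[[_ _ ju] _] <-] <-].
apply: filterS => g hg u ue; have Bu : B u by rewrite /B /closed_ball_/= distrC.
have [[iu cu _] [J1 J2]] := hB u Bu.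
have [|gj g1 g2] := hg (par X i u); first by exists u.
rewrite cu in g1 g2.
have dg : differentiable (chart_rep g i j) u.
  by rewrite -cu; have [] := chart_rep_differentiable (local_diffeoP g) iu gj.
split; first exact: (And3 iu cu gj).
exact: (And3 dg (ler_dist_halves (ltW g2) J1) (ler_dist_halves (ltW g1) J2)).
Qed.

End NearbyDiffeos.

(** The radius [r] is at once the size of the neighbourhood and the scale in [P]. Since [P] survives
    a decrease of the scale, finitely many neighbourhoods share one. *)
Lemma compact_uniform (R : realType) (M : metricType R) (I : Type)
    (F : set_system I) (P : R -> I -> M -> Prop) :
  Filter F -> compact [set: M] ->
  (forall r r' i x, 0 < r' -> r' <= r -> P r i x -> P r' i x) ->
  (forall x0, exists2 r, 0 < r &
     \forall i \near F, forall x, mdist x0 x < r -> P r i x) ->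
  exists2 r, 0 < r & \forall i \near F, forall x, P r i x.
Proof.
move=> FF cM Pmono loc.
have [[A B] /= [A0 FB] AB] : \forall p \near filter_prod (0^'+ : set_system R) F,
    [set: M] `<=` (fun x => P p.1 p.2 x).
  apply: (iffLR (compact_near_coveringP [set: M]) cM _ _ (fun p x => P p.1 p.2 x)).
  move=> x _; have [r r0 hr] := loc x.
  exists (ball x r, [set t | 0 < t <= r] `*` [set i | forall y, mdist x y < r -> P r i y]).
    split => /=; first exact: nbhsx_ballx.
    exists ([set t | 0 < t <= r], [set i | forall y, mdist x y < r -> P r i y]) => //=.
    split=> //; near=> t; apply/andP; split; near: t; first exact: nbhs_right_gt.
    exact: nbhs_right_le.
  move=> [y [t i]] [/= xy [/andP[t0 tr] hi]].
  by apply: (Pmono r) => //; apply: hi; move: xy; rewrite ballEmdist.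
have [r [Ar r0]] : exists r : R, A r /\ 0 < r.
  apply: (@filter_ex _ (0^'+ : set_system R)).
  by apply: filterI A0 _; exact: nbhs_right_gt.
exists r => //; apply: filterS FB => i Bi x.
exact: (AB (r, i) (conj Ar Bi) x).
Unshelve. all: by end_near. Qed.

Section UniformLocal.
Context {R : realType} {M : metricType R} {n : nat} (X : riemannian_structure M n).
Implicit Types (f g : local_diffeo X) (i j : chart X) (x : M).

Lemma nbhs_mdist_ex x (A : set M) : nbhs x A ->
  exists2 r, 0 < r & forall y, mdist x y < r -> A y.
Proof.
by move=> /nbhs_ballP[r /= r0 h]; exists r => // y xy; apply: h; rewrite ballEmdist.
Qed.

Lemma crd_near i x (s : R) : dom X i x -> 0 < s ->
  exists2 r, 0 < r & forall y, mdist x y < r ->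
    dom X i y /\ `|crd X i y - crd X i x| <= s.
Proof.
move=> ix s0; apply: nbhs_mdist_ex; apply: filterI.
  by apply: open_nbhs_nbhs; split=> //; exact: open_dom.
have /cvgrPdistC_le /(_ _ s0) := @crd_continuous _ _ _ X i x ix.
exact.
Qed.

Lemma par_near i x (e : R) : dom X i x -> 0 < e ->
  exists2 t, 0 < t & forall u, `|u - crd X i x| <= t -> mdist x (par X i u) < e.
Proof.
move=> ix e0.
have cp : par X i @ nbhs (crd X i x) --> x.
  by rewrite -{2}(crdK ix); apply: par_continuous; exists x.
have /nbhs_ballP[t /= t0 ht] : nbhs (crd X i x) (par X i @^-1` ball x e).
  by apply: cp; exact: nbhsx_ballx.
exists (t / 2); first by rewrite divr_gt0.
move=> u ut; have : ball (crd X i x) t u.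
  by rewrite -ball_normE/= /ball_/= distrC (le_lt_trans ut)// ltr_pdivrMr// ltr_pMr// ltr1n.
by move=> /ht /=; rewrite ballEmdist.
Qed.

Lemma near_eval f x (e : R) : 0 < e -> exists2 r, 0 < r &
  nbhs f [set g : local_diffeo X | forall y, mdist x y < r -> mdist (f x) (g y) < e].
Proof.
move=> e0; have ix := dom_chart_at X x; have jfx := dom_chart_at X (f x).
have [t t0 ht] := par_near jfx e0.
have [s s0 hs] := near_chart_rep ix jfx t0.
have [r r0 hr] := crd_near ix s0.
exists r => //; apply: filterS hs => g hg y /hr[iy ys].
have [[iu cu ju] [_ _ gt]] := hg _ ys.
rewrite (crdK iy) in ju.
have := ht _ gt; rewrite /chart_rep/= (crdK iy) crdK//.
Qed.

(** This tolerance meets [k_small]; the [+ 1] keeps the denominator positive, also in dimension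
    0. *)
Lemma small_jacobian_bound m (A : 'M[R]_m) :
  m%:R * `|invmx A| * (m%:R * (1 / 2 / (m%:R * `|invmx A| * m%:R + 1))) <= 1 / 2.
Proof.
set a := m%:R * `|invmx A|; have a0 : 0 <= a * m%:R by rewrite !mulr_ge0.
rewrite !mulrA ler_pdivrMr ?ltr_wpDl//; lra.
Qed.

Section LocalAt.
Variables (f : local_diffeo X) (x : M).
Let i := chart_at X x.
Let j := chart_at X (f x).
Let A := 'J (chart_rep f i j) (crd X i x).
Let L := n%:R * `|invmx A|.
Let k := 1 / 2 / (L * n%:R + 1).
Let L0 : 0 <= L. Proof. by rewrite mulr_ge0. Qed.
Let k0 : 0 < k.
Proof. by rewrite divr_gt0// ltr_wpDl// mulr_ge0. Qed.

Lemma local_injective_at_scale : exists2 r, 0 < r &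
  nbhs f [set g : local_diffeo X | forall y, mdist x y < r ->
    forall z, mdist y z < r -> g y = g z -> y = z].
Proof.
have ix := dom_chart_at X x; have jfx := dom_chart_at X (f x).
have [s s0 hs] := near_chart_rep ix jfx k0.
have uA := jacobian_chart_rep_unit (local_diffeoP f) ix jfx.
have [r r0 hr] := crd_near ix s0.
exists (r / 2); first by rewrite divr_gt0.
apply: filterS hs => g hg y xy z yz gyz.
have [iy ys] : dom X i y /\ `|crd X i y - crd X i x| <= s by apply: hr; lra.
have [iz zs] : dom X i z /\ `|crd X i z - crd X i x| <= s.
  by apply: hr; have := metric_triangle x y z; lra.
rewrite -(crdK iy) -(crdK iz); congr (par X i _).
apply: (jacobian_injective (F := chart_rep g i j) (A := A) (k := k) _ uA _ ys zs).
- by move=> u /hg[_ [dg Jg _]].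
- exact: small_jacobian_bound.
- by rewrite /chart_rep/= !crdK// gyz.
Qed.

Lemma local_open_at_scale (e : R) : 0 < e -> exists2 r, 0 < r &
  nbhs f [set g : local_diffeo X | forall y, mdist x y < r ->
    forall z, mdist (g y) z < r -> exists2 w, mdist y w < e & g w = z].
Proof.
move=> e0; have ix := dom_chart_at X x; have jfx := dom_chart_at X (f x).
have [s s0 hs] := near_chart_rep ix jfx k0.
have uA := jacobian_chart_rep_unit (local_diffeoP f) ix jfx.
have [t t0 ht] := par_near ix (divr_gt0 e0 (ltr0n R 2)).
pose s1 := Num.min s t; have s10 : 0 < s1 by rewrite lt_min s0.
have s1s : s1 <= s by rewrite ge_min lexx.
have s1t : s1 <= t by rewrite ge_min lexx orbT.
have [r1 r10 hr1] := crd_near ix (divr_gt0 s10 (ltr0n R 2)).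
(* Both [z] and [g y] lie within [q] of [f x] in the chart, so [L] times their distance is at most 2
   L q <= s1 / 4, as [jacobian_surjective] requires. *)
pose q := s1 / (8 * (L + 1)).
have q0 : 0 < q by rewrite divr_gt0// mulr_gt0// ltr_wpDl.
have [r2 r20 hr2] := crd_near jfx q0.
have [r3 r30 hr3] := near_eval f x (divr_gt0 r20 (ltr0n R 2)).
pose r := Num.min (Num.min r1 r3) (Num.min (r2 / 2) (e / 2)).
have rP : [/\ r <= r1, r <= r3, r <= r2 / 2 & r <= e / 2].
  by split; rewrite /r !ge_min lexx ?orbT.
case: rP => rr1 rr3 rr2 re.
exists r; first by rewrite !lt_min r10 r30 !divr_gt0.
apply: filterS (filterI hs hr3) => g [hg hg3] y xy z gyz.
have [iy ys] : dom X i y /\ `|crd X i y - crd X i x| <= s1 / 2 by apply: hr1; lra.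
have gy : mdist (f x) (g y) < r2 / 2 by apply: hg3; lra.
have [jgy gyq] : dom X j (g y) /\ `|crd X j (g y) - crd X j (f x)| <= q.
  by apply: hr2; lra.
have [jz zq] : dom X j z /\ `|crd X j z - crd X j (f x)| <= q.
  by apply: hr2; have := metric_triangle (f x) (g y) z; lra.
have gE : chart_rep g i j (crd X i y) = crd X j (g y) by rewrite /chart_rep/= crdK.
have Lq : L * `|crd X j z - chart_rep g i j (crd X i y)| <= s1 / 2 / 2.
  rewrite gE; apply: (@le_trans _ _ (L * (q * 2))).
    apply: ler_wpM2l => //; apply: (ler_dist_halves (b := crd X j (f x))).
      by rewrite mulfK.
    by rewrite mulfK// distrC.
  have : (L + 1) * (q * 8) = s1.
    by rewrite /q mulrA mulrCA [8 * (L + 1)]mulrC -!mulrA; field; rewrite gt_eqF// ltr_wpDl.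
  nra.
have FA u : `|u - crd X i x| <= s1 ->
    differentiable (chart_rep g i j) u /\ `|'J (chart_rep g i j) u - A| <= k.
  by move=> us; have [_ [dg Jg _]] := hg u (le_trans us s1s).
have s120 : 0 <= s1 / 2 by rewrite divr_ge0// ltW.
have [u us uz] := jacobian_surjective FA uA (small_jacobian_bound A) s120 (lexx _) ys Lq.
have us1 : `|u - crd X i x| <= s1.
  apply: (ler_dist_halves us ys).
have [[iu cu ju] _] := hg u (le_trans us1 s1s).
exists (par X i u).
  have := ht u (le_trans us1 s1t).
  by have := metric_triangle y x (par X i u); rewrite (metric_sym y x); lra.
by rewrite -(crdK ju) -(crdK jz) -uz.
Qed.

End LocalAt.

Section Uniform.
Hypothesis cM : compact [set: M].
Variable f : local_diffeo X.

Lemma near_injective_at_scale : exists2 e, 0 < e &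
  nbhs f [set g : local_diffeo X | injective_at_scale e g].
Proof.
apply: (@compact_uniform R M _ (nbhs f) (fun r (g : local_diffeo X) y =>
    forall z, mdist y z < r -> g y = g z -> y = z) (nbhs_filter f) cM).
- by move=> r r' g y r'0 r'r h z yz; apply: h; exact: lt_le_trans r'r.
- by move=> x; have [r r0 hr] := local_injective_at_scale f x; exists r.
Qed.

Lemma near_open_at_scale (e : R) : 0 < e -> exists2 d, 0 < d &
  nbhs f [set g : local_diffeo X | forall x z, mdist (g x) z < d ->
    exists2 y, mdist x y < e & g y = z].
Proof.
move=> e0; apply: (@compact_uniform R M _ (nbhs f) (fun r (g : local_diffeo X) y =>
    forall z, mdist (g y) z < r -> exists2 w, mdist y w < e & g w = z)
    (nbhs_filter f) cM).
- by move=> r r' g y r'0 r'r h z yz; apply: h; exact: lt_le_trans r'r.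
- by move=> x; have [r r0 hr] := local_open_at_scale f x e0; exists r.
Qed.

Lemma near_close (s : R) : 0 < s ->
  nbhs f [set g : local_diffeo X | forall x, mdist (f x) (g x) < s].
Proof.
move=> s0; have [//||r _ //] := @compact_uniform R M _ (nbhs f)
  (fun _ (g : local_diffeo X) y => mdist (f y) (g y) < s) (nbhs_filter f) cM.
move=> x; have s20 : 0 < s / 2 by rewrite divr_gt0.
have [r1 r10 hr1] := near_eval f x s20.
exists r1 => //; apply: filterS (hr1) => g hg y xy.
have h1 := nbhs_singleton hr1 y xy; have h2 := hg y xy.
rewrite (le_lt_trans (metric_triangle _ (f x) _))// (splitr s) ltrD//.
by rewrite metric_sym.
Qed.

Lemma local_diffeo_uniformly_open : uniformly_open f.
Proof.
by move=> e e0; have [d d0 /nbhs_singleton hd] := near_open_at_scale e0; exists d.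
Qed.

End Uniform.

End UniformLocal.

(** * Hyperbolic times and backward shadowing *)

(* To be read with [w] an increment of a map along [v], and [a], [b] the images
   of [v] under its differentials at two nearby points. *)
Lemma perturbed_norm_bound (R : realType) (V : normedModType R) (N : V -> R)
    (w a b v : V) (c C L k mu eps r : R) :
  (forall x y, N (x + y) <= N x + N y) ->
  (forall x, c * `|x| <= N x <= C * `|x|) -> 0 < c -> 0 < C -> 0 <= L -> 0 <= k ->
  `|w - a| <= k * `|v| -> `|a - b| <= k * `|v| -> `|v| <= L * `|a| ->
  L * k <= mu -> mu <= 1 / 2 -> 4 * C * mu <= c * (1 - expR (- eps)) -> 0 < eps ->
  N w <= r -> N b <= expR eps * r.
Proof.
move=> ND hN c0 C0 L0 k0 h1 h2 h4 Lk mu1 mu2 eps0 zr.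
have e1 : 0 < 1 - expR (- eps) by rewrite subr_gt0 -expR0 ltr_expR oppr_lt0.
have h3 : `|w - b| <= 2 * (k * `|v|) by have := ler_distD a w b; lra.
have h5 : `|a| <= `|b| + k * `|v|.
  by have := ler_normD b (a - b); rewrite addrC subrK; lra.
have h6 : `|v| <= 2 * (L * `|b|).
  have : L * `|a| <= L * (`|b| + k * `|v|) by rewrite ler_wpM2l.
  have : L * k * `|v| <= 1 / 2 * `|v| by rewrite ler_wpM2r//; lra.
  lra.
have /andP[n1 _] := hN b; have /andP[_ n2] := hN (b - w).
have n3 : N b <= N w + N (b - w) by have := ND w (b - w); rewrite addrC subrK.
(* The chain is |w - b| <= 2 k |v| <= 4 L k |b| <= 4 mu |b|, which is where the factor 4 C mu of the
   hypothesis comes from. *)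
have n4 : C * `|b - w| <= (1 - expR (- eps)) * N b.
  rewrite distrC; apply: (@le_trans _ _ (C * (4 * mu * `|b|))).
    apply: ler_wpM2l; first exact: ltW.
    have : k * `|v| <= k * (2 * (L * `|b|)) by rewrite ler_wpM2l.
    have : L * k * `|b| <= mu * `|b| by rewrite ler_wpM2r.
    lra.
  apply: (@le_trans _ _ (c * (1 - expR (- eps)) * `|b|)).
    by rewrite !mulrA [C * 4]mulrC ler_wpM2r.
  by rewrite [c * _]mulrC -mulrA ler_wpM2l// ltW.
by rewrite -ler_pdivrMl ?expR_gt0// -expRN; lra.
Qed.

Section LocalExpansion.
Context {R : realType} {M : metricType R} {n : nat} (X : riemannian_structure M n).
Implicit Types (f g : local_diffeo X) (i j : chart X) (x : M).

Definition chart_ball i x (r : R) : set M :=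
  [set y | dom X i y /\ gram_norm (chart_gram i x) (crd X i y - crd X i x) <= r].

Lemma chart_gram_equiv_near i x : dom X i x ->
  exists2 c, 0 < c & exists2 C, 0 < C & exists2 r, 0 < r &
    forall y, mdist x y < r -> forall v,
      c * `|v| <= gram_norm (chart_gram i y) v <= C * `|v|.
Proof.
move=> ix; have [c c0 [C C0 h]] := chart_gram_equiv ix.
exists c => //; exists C => //; exact: nbhs_mdist_ex h.
Qed.

Lemma local_diffeo_mdist_near f x (e : R) : 0 < e ->
  exists2 r, 0 < r & forall y, mdist x y < r -> mdist (f x) (f y) < e.
Proof.
by move=> e0; have [r r0 /nbhs_singleton hr] := near_eval f x e0; exists r.
Qed.

(* The Jacobian at [crd X i x] is compared with its value [A] at the centre of
   the neighbourhood only up to the factor [expR eps]; the sharp constant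
   [inv_differential_norm X f x] is the one at [x] itself. *)
Lemma local_expansion f i j x0 (eps : R) : dom X i x0 -> dom X j (f x0) -> 0 < eps ->
  exists2 r0, 0 < r0 & forall x, mdist x0 x < r0 -> forall r z, r <= r0 ->
    dom X i x -> dom X j (f x) ->
    chart_ball j (f x) r z ->
    exists2 y, chart_ball i x (inv_differential_norm X f x * (expR eps * r)) y & f y = z.
Proof.
move=> ix0 jx0 eps0; have hf := local_diffeoP f.
have uA := jacobian_chart_rep_unit hf ix0 jx0.
set A := 'J (chart_rep f i j) (crd X i x0) in uA.
pose L := n%:R * `|invmx A|; have L0 : 0 <= L by rewrite mulr_ge0.
have [c c0 [C C0 [r1 r10 hr1]]] := chart_gram_equiv_near jx0.
have e1 : 0 < 1 - expR (- eps) by rewrite subr_gt0 -expR0 ltr_expR oppr_lt0.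
(* The first bound serves the inverse function theorem, the second keeps the distortion of the Gram
   norm below [expR eps]. *)
pose mu := Num.min (1 / 2) (c * (1 - expR (- eps)) / (4 * C)).
have mu0 : 0 < mu by rewrite lt_min !divr_gt0// !mulr_gt0.
have mu1 : mu <= 1 / 2 by rewrite ge_min lexx.
have mu2 : 4 * C * mu <= c * (1 - expR (- eps)).
  by rewrite mulrC -ler_pdivlMr ?mulr_gt0// ge_min lexx orbT.
pose k := mu / (L * n%:R + 1).
have Ln0 : 0 <= L * n%:R by rewrite mulr_ge0.
have k0 : 0 < k by rewrite divr_gt0// ltr_wpDl.
have Lk : L * (n%:R * k) <= mu.
  by rewrite /k !mulrA ler_pdivrMr ?ltr_wpDl// mulrC ler_pM2l// lerDl.
have [s s0 /nbhs_singleton hs] := near_chart_rep ix0 jx0 k0.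
have FA u : `|u - crd X i x0| <= s ->
    differentiable (chart_rep f i j) u /\ `|'J (chart_rep f i j) u - A| <= k.
  by move=> us; have [_ [df Jf _]] := hs u us.
have s20 : 0 < s / 2 by rewrite divr_gt0.
have [r2 r20 hr2] := crd_near ix0 s20.
have [r3 r30 hr3] := local_diffeo_mdist_near f x0 r10.
pose q := c * s / (4 * (L + 1)).
have L10 : 0 < L + 1 by rewrite ltr_wpDl.
have q0 : 0 < q by rewrite divr_gt0// mulr_gt0.
pose r0 := Num.min r2 (Num.min r3 q).
have [r02 r03 r0q] : [/\ r0 <= r2, r0 <= r3 & r0 <= q].
  by rewrite /r0; split; rewrite !ge_min lexx ?orbT.
exists r0; first by rewrite !lt_min r20 r30.
move=> x xr r z rr0 ix jx [jz zr].
have [_ xs] := hr2 x (lt_le_trans xr r02).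
have hN := hr1 (f x) (hr3 x (lt_le_trans xr r03)).
set w := crd X j z - crd X j (f x) in zr.
have Fx : chart_rep f i j (crd X i x) = crd X j (f x) by rewrite /chart_rep/= crdK.
have Lw : L * `|crd X j z - chart_rep f i j (crd X i x)| <= s / 2 / 2.
  rewrite Fx -/w; have /andP[cw _] := hN w.
  have cwq : c * `|w| <= q by lra.
  have qE : q * (4 * (L + 1)) = c * s by rewrite /q divfK// gt_eqF// mulr_gt0.
  have h : (4 * (L + 1)) * (c * `|w|) <= c * s.
    by rewrite -qE [leRHS]mulrC ler_pM2l ?mulr_gt0.
  have h' : (L + 1) * `|w| * 4 <= s.
    by rewrite -(ler_pM2l c0); move: h; lra.
  have : L * `|w| <= (L + 1) * `|w| by rewrite ler_wpM2r// lerDl.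
  lra.
have Lk2 : L * (n%:R * k) <= 1 / 2 by lra.
have [u us uz] := jacobian_surjective FA uA Lk2 (ltW s20) (lexx _) xs Lw.
have us0 : `|u - crd X i x0| <= s by apply: (ler_dist_halves us xs).
have xs0 : `|crd X i x - crd X i x0| <= s by lra.
have [[iu cu ju] _] := hs u us0.
exists (par X i u); last by rewrite -(crdK ju) -(crdK jz) -uz.
split=> //; rewrite cu; set v := u - crd X i x.
set B := 'J (chart_rep f i j) (crd X i x).
have h1 : `|w - v *m A| <= n%:R * k * `|v|.
  by have := jacobian_lipschitz FA us0 xs0; rewrite uz Fx.
have h2 : `|v *m A - v *m B| <= n%:R * k * `|v|.
  rewrite -mulmxBr (le_trans (norm_mulmx_le _ _))// -mulrA ler_wpM2l// mulrC.
  by rewrite ler_wpM2r// distrC; exact: (proj2 (FA _ xs0)).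
have h4 : `|v| <= L * `|v *m A| by exact: norm_mulmx_le_r.
have ND a b := gram_normD a b (positive_definite_chart_gram jx).
have nk0 : 0 <= n%:R * k by rewrite mulr_ge0// ltW.
have n5 := perturbed_norm_bound ND hN c0 C0 L0 nk0 h1 h2 h4 Lk mu1 mu2 eps0 zr.
apply: le_trans (gram_norm_inv_differential v hf ix jx) _.
exact: (ler_wpM2l (inv_differential_norm_ge0 X f x) n5).
Qed.

Lemma chart_ball_mdist i x0 (d : R) : dom X i x0 -> 0 < d ->
  exists2 r0, 0 < r0 & forall x, mdist x0 x < r0 -> forall y,
    chart_ball i x r0 y -> mdist x y < d.
Proof.
move=> ix0 d0; have d20 : 0 < d / 2 by rewrite divr_gt0.
have [t t0 ht] := par_near ix0 d20.
have t20 : 0 < t / 2 by rewrite divr_gt0.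
have [r1 r10 hr1] := crd_near ix0 t20.
have [c c0 [C C0 [r2 r20 hr2]]] := chart_gram_equiv_near ix0.
have ct0 : 0 < c * (t / 2) by rewrite mulr_gt0.
pose r0 := Num.min (Num.min r1 r2) (Num.min (c * (t / 2)) (d / 2)).
have [h1 h2 h3 h4] : [/\ r0 <= r1, r0 <= r2, r0 <= c * (t / 2) & r0 <= d / 2].
  by rewrite /r0; split; rewrite !ge_min lexx ?orbT.
exists r0; first by rewrite !lt_min r10 r20 ct0.
move=> x xr y [iy yr].
have [ix xt] := hr1 x (lt_le_trans xr h1).
have /andP[cy _] := hr2 x (lt_le_trans xr h2) (crd X i y - crd X i x).
have yt : `|crd X i y - crd X i x| <= t / 2 by rewrite -(ler_pM2l c0); lra.
have := ht _ (ler_dist_halves yt xt); rewrite crdK// => x0y.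
by have := metric_triangle x x0 y; rewrite (metric_sym x x0); lra.
Qed.

Lemma mdist_chart_ball i x0 (r : R) : dom X i x0 -> 0 < r ->
  exists2 d, 0 < d & forall x, mdist x0 x < d -> forall y,
    mdist x y < d -> chart_ball i x r y.
Proof.
move=> ix0 r0; have [c c0 [C C0 [r2 r20 hr2]]] := chart_gram_equiv_near ix0.
pose q := r / C; have q0 : 0 < q by rewrite divr_gt0.
have [r1 r10 hr1] := crd_near ix0 (divr_gt0 q0 (ltr0n R 2)).
pose d := Num.min (r1 / 2) r2.
have [h1 h2] : d <= r1 / 2 /\ d <= r2 by rewrite !ge_min !lexx orbT.
exists d; first by rewrite lt_min r20 divr_gt0.
move=> x xd y yd.
have [ix xq] : dom X i x /\ `|crd X i x - crd X i x0| <= q / 2 by apply: hr1; lra.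
have [iy yq] : dom X i y /\ `|crd X i y - crd X i x0| <= q / 2.
  by apply: hr1; have := metric_triangle x0 x y; lra.
split=> //; rewrite distrC in xq.
have /andP[_ yC] := hr2 x (lt_le_trans xd h2) (crd X i y - crd X i x).
apply: (le_trans yC); rewrite mulrC -ler_pdivlMr//.
exact: (ler_dist_halves yq xq).
Qed.

End LocalExpansion.

(** The sums [S m] of ln b_j + eps tend to minus infinity along with - (c - eps) m / 2. A time at
    which [S] reaches a new minimum has all its final products at most 1. *)
Lemma hyperbolic_times (R : realType) (b : nat -> R) (c eps : R) :
  (forall j, 0 < b j) -> eps < c ->
  (limn_esup (fun m : nat => (m%:R^-1)%:E * \sum_(j < m) lne (b j)%:E)
     <= (- c)%:E)%E ->
  forall N, exists2 m, (N <= m)%N &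
    forall k, (k <= m)%N -> \prod_(k <= j < m) (b j * expR eps) <= 1.
Proof.
move=> b0 epsc lims N.
pose S m := \sum_(0 <= j < m) (ln (b j) + eps).
pose c' := (c + eps) / 2.
have [V [m0 _ hm0] hV] : exists2 V : set nat, \oo V & forall m, V m ->
    \sum_(j < m) ln (b j) <= - c' * m%:R.
  have /(le_lt_trans lims) : ((- c)%:E < (- c')%:E)%E by rewrite lte_fin /c'; lra.
  move=> /ereal_inf_lt[_ [V FV <-] hV]; exists (V `&` [set m | (0 < m)%N]).
    by apply: filterI => //; exact: nbhs_infty_gt.
  move=> m [Vm m_gt0].
  have : ((m%:R^-1)%:E * \sum_(j < m) lne (b j)%:E <= (- c')%:E)%E.
    by apply: le_trans (ltW hV); apply: ereal_sup_ubound; exists m.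
  under eq_bigr do rewrite lne_EFin//.
  by rewrite sumEFin -EFinM lee_fin mulrC ler_pdivrMr ?ltr0n.
have Sdown a : exists m, S m < a.
  pose d := c' - eps; have d0 : 0 < d by rewrite /d /c'; lra.
  pose m := maxn m0 (Num.truncn (`|a| / d)).+1.
  exists m; have Vm : V m by apply: hm0; rewrite /= leq_maxl.
  have := hV m Vm; rewrite /S big_mkord big_split/= sumr_const card_ord -mulr_natr.
  have : `|a| < d * m%:R.
    rewrite mulrC -ltr_pdivrMr// (lt_le_trans (truncnS_gt _))// ler_nat.
    exact: leq_maxr.
  by have := ler_norm (- a); rewrite normrN /d; lra.
(* This level lies below S_0, ..., S_N, so the first time at which [S] drops under it comes after
   [N]; being the first, it is a record minimum. *)
pose a := - \sum_(0 <= k < N.+1) `|S k|.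
have aS k : (k <= N)%N -> a <= S k.
  move=> kN; rewrite /a lerNl (le_trans (ler_norm _))// normrN.
  rewrite big_mkord (bigD1 (Ordinal (kN : (k < N.+1)%N)))//= lerDl.
  exact: sumr_ge0.
have exm : exists m, S m < a by exact: Sdown.
case: (ex_minnP exm) => m Sm minm.
have Nm : (N <= m)%N.
  by rewrite leqNgt; apply/negP => /ltnW /aS; rewrite leNgt Sm.
exists m => // k km.
have -> : \prod_(k <= j < m) (b j * expR eps) = expR (S m - S k).
  have -> : S m = S k + \sum_(k <= j < m) (ln (b j) + eps).
    by rewrite /S -big_cat_nat.
  rewrite addrAC subrr add0r expR_sum.
  by apply: eq_bigr => j _; rewrite expRD lnK// posrE.
rewrite -expR0 ler_expR subr_le0.
have [->//|kltm] := eqVneq k m.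
have {}kltm : (k < m)%N by rewrite ltn_neqAle kltm.
rewrite (le_trans (ltW Sm))// leNgt; apply/negP => /minm.
by rewrite leqNgt kltm.
Qed.

Lemma seq_uniform (R : realType) (T : eqType) (s : seq T) (Q : R -> T -> Prop) :
  (forall r r' a, 0 < r' -> r' <= r -> Q r a -> Q r' a) ->
  (forall a, a \in s -> exists2 r, 0 < r & Q r a) ->
  exists2 r, 0 < r & forall a, a \in s -> Q r a.
Proof.
move=> Qmono; elim: s => [|a s IHs] h; first by exists 1.
have [|r r0 hr] := IHs; first by move=> b bs; apply: h; rewrite inE bs orbT.
have [|r' r'0 hr'] := h a; first by rewrite inE eqxx.
have m0 : 0 < Num.min r r' by rewrite lt_min r0.
exists (Num.min r r') => // b; rewrite inE => /predU1P[->|bs].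
  by apply: (Qmono r') => //; rewrite ge_min lexx orbT.
by apply: (Qmono r) => //; [rewrite ge_min lexx|exact: hr].
Qed.

Lemma compact_uniform_radius (R : realType) (M : metricType R) (P : R -> M -> Prop) :
  compact [set: M] -> (forall r r' x, 0 < r' -> r' <= r -> P r x -> P r' x) ->
  (forall x0, exists2 r, 0 < r & forall x, mdist x0 x < r -> P r x) ->
  exists2 r, 0 < r & forall x, P r x.
Proof.
move=> cM Pmono loc.
have [||r r0 h] := @compact_uniform R M unit (globally setT) (fun r _ x => P r x)
  (globally_filter _) cM.
- by move=> r r' _ x; exact: Pmono.
- by move=> x; have [r r0 hr] := loc x; exists r => // i _; exact: hr.
by exists r => // x; exact: (h tt Logic.I x).
Qed.

Section Shadowing.
Context {R : realType} {M : metricType R} {n : nat} (X : riemannian_structure M n).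
Implicit Types (f : local_diffeo X) (x : M).

Lemma inv_differential_norm_gt0 f x : (0 < n)%N -> 0 < inv_differential_norm X f x.
Proof.
move=> n0; rewrite lt_def inv_differential_norm_ge0 andbT; apply/eqP => b0.
pose v : 'rV[R]_n := const_mx 1.
have v0 : v != 0.
  by apply/eqP => /rowP /(_ (Ordinal n0)); rewrite !mxE => /eqP; rewrite oner_eq0.
have := inv_differential_norm_ub x v (local_diffeoP f).
rewrite b0 mul0r leNgt => /negP[]; rewrite tangent_normE.
by apply: gram_norm_gt0 => //; exact/positive_definite_chart_gram/dom_chart_at.
Qed.

Lemma inv_differential_norm_dim0 f x : n = 0%N -> inv_differential_norm X f x = 0.
Proof.
move=> n0; have v0 (v : 'rV[R]_n) : v = 0.
  by apply/rowP => -[j jn]; exfalso; move: jn; rewrite n0.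
rewrite /inv_differential_norm [X in sup X](_ : _ = [set 0]) ?sup1//.
apply/seteqP; split => [_ [w _ <-]|_ ->] /=.
  by rewrite tangent_normE [_ *m _]v0 gram_norm0.
by exists 0; rewrite ?mul0mx tangent_normE gram_norm0.
Qed.

Lemma expanding_hyperbolic_times f x (c eps : R) : eps < c ->
  expanding_set X c f x -> forall N, exists2 m, (N <= m)%N &
    forall k, (k <= m)%N ->
      \prod_(k <= j < m) (inv_differential_norm X f (iter j f x) * expR eps) <= 1.
Proof.
move=> epsc fx N; have [n0|n0] := posnP n; last first.
  apply: (@hyperbolic_times _ (fun j => inv_differential_norm X f (iter j f x)) c) => //.
  by move=> j; exact: inv_differential_norm_gt0.
(* In dimension 0 the norm vanishes: a product is 1 if empty and 0 otherwise, so every time is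
   hyperbolic. *)
exists N => // k; rewrite leq_eqVlt => /predU1P[->|kN]; first by rewrite big_geq.
by rewrite big_ltn// inv_differential_norm_dim0// !mul0r.
Qed.

(** The patches are closed balls inside chart domains, so that lying outside a patch is an open
    condition; [patch_uniform] relies on this. *)
Lemma finite_atlas : compact [set: M] ->
  exists (s : seq M) (rho : M -> R),
    (forall a y, mdist a y <= rho a -> dom X (chart_at X a) y) /\
    forall y, exists2 a, a \in s & mdist a y <= rho a.
Proof.
move=> cM; have [rho hrho] : {rho : M -> R & forall a, 0 < rho a /\
    forall y, mdist a y <= rho a -> dom X (chart_at X a) y}.
  apply: (@choice M R (fun a r => 0 < r /\
    forall y, mdist a y <= r -> dom X (chart_at X a) y)) => a.
  have [r r0 hr] := crd_near (dom_chart_at X a) ltr01.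
  exists (r / 2); split; first by rewrite divr_gt0.
  by move=> y ay; apply: (proj1 (hr y _)); lra.
have [||s _ cov] := @finite_subcover M M [set: M] [set: M] (fun a => ball a (rho a)) => //.
  by move=> y _; exists y => //; apply: nbhsx_ballx; case: (hrho y).
exists s, rho; split; first by move=> a; case: (hrho a).
move=> y; have [//|a sa ya] := cov y.
by exists a => //; move: ya; rewrite ballEmdist => /ltW.
Qed.

Section Patches.
Hypothesis cM : compact [set: M].
Variables (f : local_diffeo X) (s : seq M) (rho : M -> R).
Hypothesis rho_dom : forall a y, mdist a y <= rho a -> dom X (chart_at X a) y.

(** Near a point of the closed patch the local statement applies; near any other point the claim is
    vacuous. Compactness and the finiteness of the atlas then give one radius. *)
Lemma patch_uniform (Q : R -> M -> M -> Prop) :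
  (forall r r' a x, 0 < r' -> r' <= r -> Q r a x -> Q r' a x) ->
  (forall a x0, dom X (chart_at X a) x0 ->
     exists2 r, 0 < r & forall x, mdist x0 x < r -> Q r a x) ->
  exists2 r, 0 < r & forall a x, a \in s -> mdist a x <= rho a -> Q r a x.
Proof.
move=> Qmono loc.
have [||r r0 hr] := @seq_uniform R M s (fun r a => forall x, mdist a x <= rho a -> Q r a x).
- by move=> r r' a r'0 r'r h x /h; exact: Qmono.
- move=> a _; apply: (@compact_uniform_radius R M
    (fun r x => mdist a x <= rho a -> Q r a x)) => //.
    by move=> r r' x r'0 r'r h /h; exact: Qmono.
  move=> x0; have [ax0|ax0] := leP (mdist a x0) (rho a).
    by have [r r0 hr] := loc a x0 (rho_dom ax0); exists r => // x /hr.
  exists (mdist a x0 - rho a); first by rewrite subr_gt0.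
  move=> x x0x ax; exfalso; have := metric_triangle a x x0.
  by rewrite (metric_sym x x0); lra.
- by exists r => // a x sa; exact: hr.
Qed.

Lemma expansion_uniform (eps : R) : 0 < eps ->
  exists2 r0, 0 < r0 & forall a b x, a \in s -> b \in s ->
    mdist a x <= rho a -> mdist b (f x) <= rho b ->
    forall r z, r <= r0 -> chart_ball (chart_at X b) (f x) r z ->
    exists2 y, chart_ball (chart_at X a) x
                 (inv_differential_norm X f x * (expR eps * r)) y & f y = z.
Proof.
move=> eps0.
have [||r0 r00 hr0] := @seq_uniform R M s (fun r0 b => forall a x, a \in s ->
    mdist a x <= rho a -> mdist b (f x) <= rho b ->
    forall r z, r <= r0 -> chart_ball (chart_at X b) (f x) r z ->
    exists2 y, chart_ball (chart_at X a) x
                 (inv_differential_norm X f x * (expR eps * r)) y & f y = z).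
- by move=> r r' b r'0 r'r h a x sa ax bx t z tr; apply: (h a x) => //; exact: le_trans r'r.
- move=> b _.
  have [||r0 r00 hr0] := @patch_uniform (fun r0 a x => dom X (chart_at X a) x ->
    mdist b (f x) <= rho b ->
    forall r z, r <= r0 -> chart_ball (chart_at X b) (f x) r z ->
    exists2 y, chart_ball (chart_at X a) x
                 (inv_differential_norm X f x * (expR eps * r)) y & f y = z).
  + by move=> r r' a x r'0 r'r h dx bx t z tr; apply: h => //; exact: le_trans r'r.
  + move=> a x0 ax0; have [bx0|bx0] := leP (mdist b (f x0)) (rho b).
      have [r0 r00 hr0] := local_expansion ax0 (rho_dom bx0) eps0.
      exists r0 => // x xr ax bx r z rr0.
      exact: (hr0 x xr r z rr0 ax (rho_dom bx)).
    have e0 : 0 < mdist b (f x0) - rho b by rewrite subr_gt0.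
    have [r r0 hr] := local_diffeo_mdist_near f x0 e0.
    exists r => // x /hr fx ax bx; exfalso.
    have := metric_triangle b (f x) (f x0).
    by rewrite (metric_sym (f x) (f x0)); lra.
  by exists r0 => // a x sa ax; apply: (hr0 a x sa ax); exact: rho_dom.
- by exists r0 => // a b x sa sb; exact: (hr0 b sb a x sa).
Qed.

End Patches.

Lemma chart_ball_le i x (r r' : R) : r <= r' ->
  chart_ball (X := X) i x r `<=` chart_ball i x r'.
Proof. by move=> rr' y [iy yr]; split=> //; exact: le_trans rr'. Qed.

(** Starting from a ball of radius [r0] at a hyperbolic time m, the pull-back to time l lives in a
    ball of radius [r0] times the product over l <= j < m. That product is at most 1, so each step
    stays within the range of the local estimate. *)
Lemma backward_shadowed_expanding f (c : R) : compact [set: M] -> 0 < c ->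
  backward_shadowed f (expanding_set X c f).
Proof.
move=> cM c0 d d0; have [s [rho [rho_dom cov]]] := finite_atlas cM.
pose eps := c / 2; have eps0 : 0 < eps by rewrite divr_gt0.
have epsc : eps < c by rewrite /eps; lra.
have [rE rE0 hE] := expansion_uniform cM f s rho_dom eps0.
have [||rD rD0 hD] := @patch_uniform cM s rho rho_dom (fun r a x => forall y,
    chart_ball (chart_at X a) x r y -> mdist x y < d).
- by move=> r r' a x r'0 r'r h y /(chart_ball_le r'r); exact: h.
- by move=> a x0 ax0; exact: chart_ball_mdist.
pose r0 := Num.min rE rD; have r00 : 0 < r0 by rewrite lt_min rE0.
have r0E : r0 <= rE by rewrite ge_min lexx.
have r0D : r0 <= rD by rewrite ge_min lexx orbT.
have [||d' d'0 hd'] := @patch_uniform cM s rho rho_dom (fun t a x => forall y,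
    mdist x y < t -> chart_ball (chart_at X a) x r0 y).
- by move=> r r' a x r'0 r'r h y xy; apply: h; exact: lt_le_trans r'r.
- by move=> a x0 ax0; exact: mdist_chart_ball.
have [al hal] : {al : M -> M & forall y, al y \in s /\ mdist (al y) y <= rho (al y)}.
  apply: (@choice M M (fun y a => a \in s /\ mdist a y <= rho a)) => y.
  by have [a sa ya] := cov y; exists a.
exists d' => // x N fx.
have [m Nm hm] := expanding_hyperbolic_times epsc fx N.
exists m => // q xq.
pose b j := inv_differential_norm X f (iter j f x) * expR eps.
(* Induction on the number [k] of backward steps from time [m]; [al] picks a chart at each orbit
   point, and the Gram norm allows it to change from step to step. *)
have key k : (k <= m)%N -> exists y, [/\ iter k f y = q,
    chart_ball (chart_at X (al (iter (m - k) f x))) (iter (m - k) f x)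
      (\prod_(m - k <= j < m) b j * r0) y &
    forall j, (j <= k)%N -> mdist (iter j f y) (iter (m - k + j) f x) < d].
  elim: k => [|k IHk] km.
    have [sa ax] := hal (iter m f x).
    have qb : chart_ball (chart_at X (al (iter m f x))) (iter m f x) r0 q.
      exact: (hd' _ _ sa ax).
    exists q; split=> //; first by rewrite subn0 big_geq// mul1r.
    move=> j; rewrite leqn0 => /eqP ->; rewrite subn0 addn0 metric_sym.
    by apply: (hD _ _ sa ax); exact: (chart_ball_le r0D).
  have [y [yq yb yd]] := IHk (ltnW km).
  set l := (m - k.+1)%N; have lE : (m - k)%N = l.+1 by rewrite /l subnSK.
  rewrite lE in yb yd.
  have lm : (l < m)%N by rewrite -lE leq_subr.
  have prod_le : \prod_(l.+1 <= j < m) b j * r0 <= r0 by rewrite ler_piMl ?(ltW r00)//; exact: hm.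
  have prod_le' : \prod_(l <= j < m) b j * r0 <= r0.
    by rewrite ler_piMl ?(ltW r00)//; apply: hm; exact: ltnW.
  have [sa ax] := hal (iter l f x); have [sb bx] := hal (iter l.+1 f x).
  have [y' y'b fy'] := hE _ _ _ sa sb ax bx _ _ (le_trans prod_le r0E) yb.
  have y'b2 : chart_ball (chart_at X (al (iter l f x))) (iter l f x)
      (\prod_(l <= j < m) b j * r0) y'.
    by rewrite big_ltn// -mulrA /b -mulrA.
  exists y'; split=> //; first by rewrite iterSr fy'.
  case=> [_|j jk].
    rewrite addn0 /= metric_sym; apply: (hD _ _ sa ax).
    by apply: chart_ball_le y'b2; exact: le_trans r0D.
  by rewrite iterSr fy' addnS -addSn; exact: yd.
have [y [yq _ yd]] := key m (leqnn m).
exists y => // j jm; have := yd j jm; by rewrite subnn add0n.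
Qed.

End Shadowing.

(** * Continuity of the pressure *)

Lemma fine_dist_le (R : realType) (x y : \bar R) (e : R) :
  x \is a fin_num -> y \is a fin_num ->
  (x <= y + e%:E)%E -> (y <= x + e%:E)%E -> `|fine x - fine y| <= e.
Proof.
case: x => [x| |]//; case: y => [y| |]// _ _; rewrite -!EFinD !lee_fin/= => h1 h2.
by rewrite ler_norml; apply/andP; split; lra.
Qed.

Lemma hoelder_dist_le (R : realType) (M : metricType R) (alpha : R)
    (phi psi : hoelder_space M alpha) x : `|phi x - psi x| <= `|phi - psi|.
Proof.
rewrite [leRHS]hoelder_space_normE /hoelder_norm -[leLHS]addr0; apply: lerD.
  have /asboolP[ub _] := hoelder_funP (phi - psi).
  by apply: (ub_le_sup ub); exists x.
have [->|/set0P[z Az]] := eqVneq (hoelder_quotients alpha (phi - psi)) set0.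
  by rewrite sup0.
have /asboolP[_ ub] := hoelder_funP (phi - psi).
apply: le_trans (ub_le_sup ub Az); case: Az => p _ <-.
by rewrite divr_ge0// powR_ge0.
Qed.

Lemma fiber_sum_ge_point (R : realType) (M : metricType R) (f : M -> M)
    (phi : M -> R) k y :
  ((expR (birkhoff_sum f phi k y))%:E <= fiber_sum f phi k (iter k f y))%E.
Proof.
rewrite -[leLHS](@esum_set1 R M y (fun z => (expR (birkhoff_sum f phi k z))%:E));
  last by rewrite lee_fin expR_ge0.
by apply: esum_subset => [z _|z ->]; rewrite ?lee_fin ?expR_ge0.
Qed.

Section Continuity.
Context {R : realType} {M : metricType R} {n : nat} (X : riemannian_structure M n).
Context {alpha : R}.
Hypothesis cM : compact [set: M].
Local Notation pairs := (local_diffeo X * hoelder_space M alpha)%type.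
Implicit Types p q : pairs.

Lemma near_potential p (w : R) : continuous p.2 -> 0 < w ->
  exists2 e, 0 < e & nbhs p [set q : pairs | forall x y : M, mdist x y < e ->
    `|q.2 x - p.2 y| <= w].
Proof.
move=> cp w0; have w20 : 0 < w / 2 by rewrite divr_gt0.
have [e e0 he] := compact_uniform_modulus cM cp w20.
exists e => //.
have near2 : nbhs p [set q : pairs | `|p.2 - q.2| < w / 2].
  exact: (@cvgr_dist_lt _ _ _ (nbhs p) _ snd p.2 cvg_snd).
apply: filterS near2 => q pq x y xy.
rewrite [w]splitr -(subrKA (p.2 x)) (le_trans (ler_normD _ _))// lerD ?he//.
by rewrite distrC (le_trans (hoelder_dist_le _ _ _))// ltW.
Qed.

Lemma near_potential_base p (w : R) : continuous p.2 -> 0 < w ->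
  exists2 e, 0 < e & nbhs p [set q : pairs | forall x y : M, mdist x y < e ->
    `|p.2 x - q.2 y| <= w].
Proof.
move=> cp w0; have [e e0 he] := near_potential cp w0.
exists e => //; apply: filterS he => q hq x y xy.
by rewrite distrC hq// metric_sym.
Qed.

Lemma near_diffeo p (N : set (local_diffeo X)) : nbhs p.1 N ->
  nbhs p [set q : pairs | N q.1].
Proof. by move=> pN; apply: cvg_fst. Qed.

(** Fibres of the fixed map are matched into those of the varying one, which takes a scale of
    openness common to all nearby maps. The reverse comparison takes a common scale of injectivity
    instead. *)
Lemma near_fiber_sum_ge p k (w : R) : continuous p.2 -> 0 < w ->
  nbhs p [set q : pairs | forall x, (fiber_sum p.1 p.2 k x <=
    (expR (k%:R * w))%:E * fiber_sum q.1 q.2 k x)%E].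
Proof.
move=> cp w0; have [e0 e00 /nbhs_singleton finj] := near_injective_at_scale cM p.1.
apply: (@near_fiber_sum_le _ _ _ (nbhs p) _ (fun q : pairs => q.1 : M -> M) (fun=> p.1) _ _
    (fun q : pairs => q.2 : M -> R) (fun=> p.2) k e0 w) => //.
- move=> e epos; have [d d0 hd] := near_open_at_scale cM p.1 epos.
  by exists d => //; exact: (near_diffeo hd).
- move=> s s0; have /near_diffeo := near_close cM p.1 s0.
  by apply: filterS => q hq x; rewrite metric_sym.
- exact: nearW.
- exact: near_potential_base.
Qed.

Lemma near_fiber_sum_le_base p k (w : R) : continuous p.2 -> 0 < w ->
  nbhs p [set q : pairs | forall x, (fiber_sum q.1 q.2 k x <=
    (expR (k%:R * w))%:E * fiber_sum p.1 p.2 k x)%E].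
Proof.
move=> cp w0; have [e0 e00 finj] := near_injective_at_scale cM p.1.
apply: (@near_fiber_sum_le _ _ _ (nbhs p) _ (fun=> p.1) (fun q : pairs => q.1 : M -> M) _ _
    (fun=> p.2) (fun q : pairs => q.2 : M -> R) k e0 w) => //.
- move=> e epos; have [d d0 hd] := local_diffeo_uniformly_open cM p.1 epos.
  by exists d => //; exact: nearW.
- by move=> s s0; exact: (near_diffeo (near_close cM p.1 s0)).
- exact: (near_diffeo finj).
- exact: near_potential.
Qed.

Section AtPair.
Variables (F : set (local_diffeo X)) (c : R).
Hypothesis c0 : 0 < c.
Variable p : local_diffeo X * hoelder_space M alpha.
Hypothesis Hp : hyperbolic_pairs F c p.

Let cf : continuous p.1. Proof. exact: local_diffeo_continuous (local_diffeoP p.1). Qed.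
Let cphi : continuous p.2. Proof. by case: Hp => _ []. Qed.
Let dense : dense_preimages p.1. Proof. by case: Hp. Qed.

(** On an empty M the expanding set equals its complement, against the strict inequality of
    pressures. *)
Lemma hyperbolic_pair_nonempty : exists x : M, True.
Proof.
apply: contrapT => nM; case: Hp => _ [_ lt _] _; move: lt.
rewrite (_ : ~` expanding_set X c p.1 = expanding_set X c p.1) ?ltxx//.
by apply/seteqP; split=> x; exfalso; apply: nM; exists x.
Qed.

Lemma pressure_le_step_growth (th : R) k : (0 < k)%N ->
  (forall y, (fiber_sum p.1 p.2 k y <= (expR (k%:R * th))%:E)%E) ->
  (pressure p.1 p.2 <= th%:E)%E.
Proof.
move=> k0 hk; have [x _] := hyperbolic_pair_nonempty.
have [e e0 /nbhs_singleton finj] := near_injective_at_scale cM p.1.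
have [_ [_ _ <-] _] := Hp.
apply: (relative_pressure_le_step_growth cM cphi e0 finj x _ dense _ k0 hk).
  exact: local_diffeo_uniformly_open.
exact: backward_shadowed_expanding.
Qed.

(** If this failed, every order k would have some point with A_k at most exp(k th), a point
    depending on k; [relative_pressure_le_growth] accepts exactly such points. *)
Lemma lt_pressure_growth (th : R) : (th%:E < pressure p.1 p.2)%E ->
  exists2 k, (0 < k)%N &
    forall x, ((expR (k%:R * th))%:E <= fiber_sum p.1 p.2 k x)%E.
Proof.
move=> thp; apply: contrapT => nk.
have [x0 _] := hyperbolic_pair_nonempty.
have [e e0 /nbhs_singleton finj] := near_injective_at_scale cM p.1.
have grow k : exists x, (fiber_sum p.1 p.2 k x <= (1 * expR (k%:R * th))%:E)%E.
  have [->|k0] := posnP k.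
    by exists x0; rewrite fiber_sum0 mul0r expR0 mulr1.
  apply: contrapT => nx; apply: nk; exists k => // x.
  rewrite leNgt; apply/negP => hx; apply: nx; exists x.
  by rewrite mul1r ltW.
move: thp; rewrite ltNge => /negP; apply.
have [_ [_ _ <-] _] := Hp.
apply: (relative_pressure_le_growth cM cphi e0 finj _ dense _ ler01 grow).
  exact: local_diffeo_uniformly_open.
exact: backward_shadowed_expanding.
Qed.

(** Order 1 suffices on both sides: A_1 is at most [D], and at least exp(- B) because every point
    has a preimage. *)
Lemma pressure_fin_num : pressure p.1 p.2 \is a fin_num.
Proof.
have [x _] := hyperbolic_pair_nonempty.
have [e e0 /nbhs_singleton finj] := near_injective_at_scale cM p.1.
have [B phiB] := compact_bounded_fun cM cphi.
have [D D0 hD] := fiber_sum_growth cM e0 finj phiB.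
have up : (pressure p.1 p.2 <= (ln D)%:E)%E.
  apply: (@pressure_le_step_growth _ 1) => // y.
  by rewrite mul1r lnK ?posrE//; have := hD 1%N y; rewrite expr1.
have low : ((- B)%:E <= pressure p.1 p.2)%E.
  apply: (@growth_le_pressure _ _ p.1 p.2 e cM cf cphi e0 finj _ 1 x) => // y.
  have [z <-] := dense_preimages_surj dense y.
  apply: le_trans (fiber_sum_ge_point p.1 p.2 1 z).
  rewrite lee_fin ler_expR mul1r.
  by have /ler_normlP[] := birkhoff_sum_bound p.1 1 z phiB; rewrite mul1r lerNl.
by rewrite fin_numElt (lt_le_trans _ low) ?ltNyr// (le_lt_trans up)// ltry.
Qed.

End AtPair.

(** Half of [e] pays for passing from pressure to growth at [p], half for the comparison of fibres;
    the hyperbolicity of [q] then turns growth back into pressure. *)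
Lemma pressure_near_le F c p (e : R) : 0 < c -> hyperbolic_pairs F c p -> 0 < e ->
  nbhs p [set q : pairs | hyperbolic_pairs F c q ->
    (pressure q.1 q.2 <= pressure p.1 p.2 + e%:E)%E].
Proof.
move=> c0 Hp e0; have cphi : continuous p.2 by case: Hp => _ [].
have cf : continuous p.1 := local_diffeo_continuous (local_diffeoP p.1).
have [e1 e10 /nbhs_singleton finj] := near_injective_at_scale cM p.1.
have fin := pressure_fin_num c0 Hp; rewrite -(fineK fin) -EFinD.
set P := fine _; have e20 : 0 < e / 2 by rewrite divr_gt0.
have [k k0 hk] : exists2 k, (0 < k)%N & forall x,
    (fiber_sum p.1 p.2 k x <= (expR (k%:R * (P + e / 2)))%:E)%E.
  apply: (pressure_lt_growth_eventually cM cf cphi e10 finj).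
  by rewrite -(fineK fin) lte_fin ltrDl.
apply: filterS (near_fiber_sum_le_base k cphi e20) => q hq Hq.
apply: (pressure_le_step_growth c0 Hq k0) => y.
apply: le_trans (hq y) _; apply: le_trans (lee_wpmul2l _ (hk y)) _.
  by rewrite lee_fin expR_ge0.
by rewrite -EFinM -expRD lee_fin ler_expR; lra.
Qed.

(** Here it is the hyperbolicity of [p] that gives a uniform lower bound at one order; after
    transfer to [q] this forces the pressure of [q] up through [growth_le_pressure]. *)
Lemma pressure_near_ge F c p (e : R) : 0 < c -> hyperbolic_pairs F c p -> 0 < e ->
  nbhs p [set q : pairs | hyperbolic_pairs F c q ->
    (pressure p.1 p.2 <= pressure q.1 q.2 + e%:E)%E].
Proof.
move=> c0 Hp e0; have cphi : continuous p.2 by case: Hp => _ [].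
have fin := pressure_fin_num c0 Hp.
have e20 : 0 < e / 2 by rewrite divr_gt0.
have [k k0 hk] : exists2 k, (0 < k)%N & forall x,
    ((expR (k%:R * (fine (pressure p.1 p.2) - e / 2)))%:E <= fiber_sum p.1 p.2 k x)%E.
  apply: (lt_pressure_growth c0 Hp).
  by rewrite -[ltRHS](fineK fin) lte_fin; lra.
apply: filterS (near_fiber_sum_ge k cphi e20) => q hq Hq.
rewrite -leeBlDr// -(fineK fin) -EFinB.
have [x _] := hyperbolic_pair_nonempty Hq.
have [e1 e10 /nbhs_singleton finj] := near_injective_at_scale cM q.1.
have cphiq : continuous q.2 by case: Hq => _ [].
have cg : continuous q.1 := local_diffeo_continuous (local_diffeoP q.1).
apply: (growth_le_pressure cM cg cphiq e10 finj x k0) => y.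
rewrite -(@lee_pmul2l _ (expR (k%:R * (e / 2)))%:E) ?lte_fin ?expR_gt0//.
apply: le_trans (hq y); apply: le_trans (hk y).
by rewrite -EFinM -expRD lee_fin ler_expR; lra.
Qed.

End Continuity.

Unset Implicit Arguments.

Theorem corollary4p3 (R : realType) (M : metricType R) (n : nat)
    (X : riemannian_structure M n) (F : set (local_diffeo X)) (alpha c : R)
    (hM : compact [set: M]) (hd : riemannian_distance X)
    (halpha : 0 < alpha) (hc : 0 < c) :
  (forall p : local_diffeo X * hoelder_space M alpha,
     hyperbolic_pairs F c p -> pressure p.1 p.2 \is a fin_num) /\
  {within hyperbolic_pairs F c,
   continuous (fun p : local_diffeo X * hoelder_space M alpha =>
                 fine (pressure p.1 p.2))}.
Proof.
split=> [p|]; first exact: pressure_fin_num.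
apply/subspace_continuousP => p Hp; apply/cvgrPdist_le => e e0.
have fp := pressure_fin_num hM hc Hp.
rewrite near_withinE.
apply: filterS (filterI (pressure_near_le hM hc Hp e0) (pressure_near_ge hM hc Hp e0)).
move=> q [le ge] Hq; have fq := pressure_fin_num hM hc Hq.
exact: fine_dist_le fp fq (ge Hq) (le Hq).
Qed.
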